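(* Let $\mathbb{K}$ be a field of characteristic $0$. Up to metric (isometric) isomorphism, the indecomposable nilpotent quadratic Lie algebras over $\mathbb{K}$ of type $3$ and nilpotent index $2$ or $3$ are: (i) The quadratic Lie algebra $(\mathfrak{n}_{3,2},B_{3,2}^{\mathbf{0}_{3\times3};1})$. (ii) The quadratic Lie algebras $\left(\mathfrak{n}_{3,3}/\mathrm{Ker}\,B_{3,3}^{0;0;A},\ \overline{B_{3,3}^{0;0;A}}\right)$ for any $3\times3$ symmetric matrix $A$ of rank $\geq2$. Moreover, the algebras obtained from $A$ and $B$ (symmetric of rank $\ge2$) are isometrically isomorphic if and only if $CBC=(\mathrm{Adj}\,P)^tCAC(\mathrm{Adj}\,P)$ for some $3\times3$ regular matrix $P$, where $C=\begin{pmatrix} 0 & 0 & 1 \\ 0 & -1 & 0 \\ 1 & 0 & 0 \end{pmatrix}$. In (ii), if $\mathbb{K}^2=\mathbb{K}$ (every element of $\mathbb{K}$ is a square) or $\mathbb{K}=\mathbb{R}$, then the algebras obtained from $A$ and $B$ are isometrically isomorphic if and only if $A$ and $B$ are congruent.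
   Context: For a Lie algebra $\mathfrak{n}$ put $\mathfrak{n}^1=\mathfrak{n}$, $\mathfrak{n}^i=[\mathfrak{n}^{i-1},\mathfrak{n}]$. A nilpotent $\mathfrak{n}$ has nilpotent index $t$ if $\mathfrak{n}^{t+1}=0$, $\mathfrak{n}^t\ne0$; its type is $\dim\mathfrak{n}/\mathfrak{n}^2$. A quadratic Lie algebra is a pair $(\mathfrak{n},B)$ with $B$ a nondegenerate symmetric bilinear form that is invariant: $B([x,y],z)=B(x,[y,z])$. Isometric (metric) isomorphisms are Lie algebra isomorphisms preserving the forms. A quadratic Lie algebra is decomposable if it contains a proper nonzero ideal on which the form is nondegenerate; otherwise indecomposable. Matrices $A,B$ are congruent if $B=P^tAP$ with $P$ invertible. $\mathrm{Adj}\,P$ is the cofactor matrix, $\mathrm{Adj}\,P=\det(P)(P^{-1})^t$ for invertible $P$. $\mathrm{Ker}(B)=\{x : B(x,y)=0\ \forall y\}$, and $\overline{B}$ is the induced nondegenerate form on the quotient by the ideal $\mathrm{Ker}(B)$. $\mathfrak{n}_{3,t}$ is the free $t$-nilpotent Lie algebra over $\mathbb{K}$ on generators $x_1,x_2,x_3$. Basis of $\mathfrak{n}_{3,2}$: $x_1,x_2,x_3,[x_2,x_1],[x_3,x_1],[x_3,x_2]$. Basis of $\mathfrak{n}_{3,3}$: these six followed by $[[x_2,x_1],x_1]$, $[[x_2,x_1],x_2]$, $[[x_2,x_1],x_3]$, $[[x_3,x_1],x_1]$, $[[x_3,x_1],x_2]$, $[[x_3,x_1],x_3]$, $[[x_3,x_2],x_2]$,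 $[[x_3,x_2],x_3]$. In these ordered bases the following invariant symmetric forms are given by block matrices: $$B_{3,2}^{\mathbf{0}_{3\times3};1}:\begin{pmatrix} 0 & C \\ C & 0 \end{pmatrix},\qquad B_{3,3}^{0;0;A}:\begin{pmatrix} 0 & 0 & A' \\ 0 & A & 0 \\ (A')^t & 0 & 0 \end{pmatrix},$$ where for $A=\begin{pmatrix} a & b & c \\ b & d & e \\ c & e & f \end{pmatrix}$, $$A'=\begin{pmatrix} 0 & a & b & 0 & b & d & c & e \\ -a & 0 & c & -b & 0 & e & 0 & f \\ -b & -c & 0 & -d & -e & 0 & -f & 0 \end{pmatrix}.$$ *)

(* Defs.v *)
From HB Require Import structures.
From mathcomp Require Import all_boot all_order all_algebra.
From mathcomp Require Import reals.

Set Implicit Arguments.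
Unset Strict Implicit.
Unset Printing Implicit Defensive.

Import GRing.Theory.
Local Open Scope ring_scope.

(* All algebras are finite dimensional: the carriers are vectTypes.  (A       *)
(* nilpotent Lie algebra of finite type is automatically finite dimensional.) *)

Section LieAlgebras.
Variables (K : fieldType) (L : vectType K) (br : {bilinear L -> L -> L}).

Definition lie_bracket : Prop :=
  (forall u, br u u = 0) /\
  (forall u v w, br u (br v w) + br v (br w u) + br w (br u v) = 0).

Definition lie_ideal (I : {vspace L}) : Prop :=
  forall u v, u \in I -> br u v \in I.

Definition commv (U V : {vspace L}) : {vspace L} :=
  <<[seq br u v | u <- vbasis U, v <- vbasis V]>>%VS.

(* lcs i is n^i, numbered from n^1 = n (lcs 0 is also n). *)
Definition lcs (i : nat) : {vspace L} :=
  iter i.-1 (fun U => commv U fullv) fullv.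

Definition nilindex (t : nat) : Prop := lcs t.+1 = 0%VS /\ lcs t != 0%VS.

Lemma memv_commv (U V : {vspace L}) u v :
  u \in U -> v \in V -> br u v \in commv U V.
Proof.
move=> uU vV; rewrite (coord_vbasis uU) (coord_vbasis vV).
rewrite linear_sumlz; apply: rpred_sum => i _; rewrite linearZl_LR rpredZ //=.
rewrite linear_sumr; apply: rpred_sum => j _; rewrite linearZr_LR rpredZ //=.
by apply: memv_span; apply: allpairs_f; rewrite mem_nth // size_tuple.
Qed.

End LieAlgebras.

Definition lie_hom (K : fieldType) (L M : vectType K)
    (brL : {bilinear L -> L -> L}) (brM : {bilinear M -> M -> M})
    (f : 'Hom(L, M)) : Prop :=
  forall u v, f (brL u v) = brM (f u) (f v).

(* (N, br) is the free t-nilpotent Lie algebra on the generators x_i, stated  *)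
(* by its universal property.                                                 *)
Definition free_nilpotent (K : fieldType) (t d : nat) (N : vectType K)
    (br : {bilinear N -> N -> N}) (x : 'I_d -> N) : Prop :=
  [/\ lie_bracket br,
      lcs br t.+1 = 0%VS
    & forall (M : vectType K) (brM : {bilinear M -> M -> M}) (y : 'I_d -> M),
        lie_bracket brM -> lcs brM t.+1 = 0%VS ->
        exists! f : 'Hom(N, M), lie_hom br brM f /\ forall i, f (x i) = y i].

Section Quotient.
Variables (K : fieldType) (L : vectType K).

(* The quotient space L / U, modelled on the complement U^C: the projection   *)
(* piq is linear, onto, and has kernel U.                                     *)
Definition quotv (U : {vspace L}) : vectType K := subvs_of (U^C)%VS.

Definition piq (U : {vspace L}) (v : L) : quotv U :=
  vsproj (U^C)%VS (daddv_pi (U^C)%VS U v).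

Definition repq (U : {vspace L}) (a : quotv U) : L := vsval a.

Fact piq_is_linear (U : {vspace L}) : linear (@piq U).
Proof. by move=> a u v; rewrite /piq !linearP. Qed.

HB.instance Definition _ (U : {vspace L}) :=
  GRing.isLinear.Build K L (quotv U) _ (@piq U) (@piq_is_linear U).

Fact repq_is_linear (U : {vspace L}) : linear (@repq U).
Proof. by move=> a u v; rewrite /repq linearP. Qed.

HB.instance Definition _ (U : {vspace L}) :=
  GRing.isLinear.Build K (quotv U) L _ (@repq U) (@repq_is_linear U).

Let capCv (U : {vspace L}) : (U^C :&: U = 0)%VS.
Proof. by rewrite capvC capv_compl. Qed.

Lemma repqK (U : {vspace L}) : cancel (@repq U) (@piq U).
Proof.
move=> a; rewrite /piq daddv_pi_id ?capCv // ?subvsP //.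
exact: vsvalK.
Qed.

Lemma piq_eq0 (U : {vspace L}) v : (piq U v == 0) = (v \in U).
Proof.
have vE : daddv_pi (U^C)%VS U v + daddv_pi U (U^C)%VS v = v.
  by apply: daddv_pi_add; rewrite ?capCv // addvC addv_complf memvf.
have piE : repq (piq U v) = daddv_pi (U^C)%VS U v.
  by rewrite /repq vsprojK // memv_pi.
apply/eqP/idP => [v0 | vU].
  by rewrite -vE -piE v0 linear0 add0r memv_pi.
have : daddv_pi (U^C)%VS U v \in (U^C :&: U)%VS.
  rewrite memv_cap memv_pi /= -[X in X \in _](addrK (daddv_pi U (U^C)%VS v)).
  by rewrite vE rpredB ?memv_pi.
by rewrite capCv memv0 /piq => /eqP ->; rewrite linear0.
Qed.

Lemma repq_piq (U : {vspace L}) v : v - repq (piq U v) \in U.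
Proof. by rewrite -piq_eq0 linearB /= repqK subrr. Qed.

Definition quot_bracket (br : {bilinear L -> L -> L}) (U : {vspace L})
    (a b : quotv U) : quotv U := piq U (br (repq a) (repq b)).

Fact quot_bracket_is_bilinear br U :
  bilinear_for *:%R *:%R (@quot_bracket br U).
Proof.
by split=> a k b c; rewrite /quot_bracket (linearP (@repq U))
  ?linearPl ?linearPr (linearP (@piq U)).
Qed.

HB.instance Definition _ br U := bilinear_isBilinear.Build K
  (quotv U) (quotv U) (quotv U) *:%R *:%R (@quot_bracket br U)
  (quot_bracket_is_bilinear br U).

Lemma piq_bracket (br : {bilinear L -> L -> L}) (U : {vspace L}) u v :
  lie_bracket br -> lie_ideal br U ->
  piq U (br u v) = quot_bracket br (piq U u) (piq U v).
Proof.
case=> brxx _ idU; apply/eqP; rewrite /quot_bracket -subr_eq0 -linearB piq_eq0.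
have brC a b : br a b = - br b a.
  apply/eqP; rewrite -addr_eq0; apply/eqP.
  by have := brxx (a + b); rewrite linearDl !linearDr !brxx add0r addr0.
set u' := repq _; set v' := repq _.
have -> : br u v - br u' v' = br (u - u') v - br (v - v') u'.
  rewrite linearBl [br (v - v') u']brC linearBr opprK addrA subrK.
  by [].
by rewrite rpredB // idU // repq_piq.
Qed.

Definition quot_form (B : {biscalar L}) (U : {vspace L})
    (a b : quotv U) : K := B (repq a) (repq b).

Fact quot_form_is_bilinear B U : bilinear_for *%R *%R (@quot_form B U).
Proof.
by split=> a k b c; rewrite /quot_form (linearP (@repq U)) ?linearPl ?linearPr.
Qed.

HB.instance Definition _ B U := bilinear_isBilinear.Build K
  (quotv U) (quotv U) K *%R *%R (@quot_form B U) (quot_form_is_bilinear B U).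

End Quotient.

Section Forms.
Variables (K : fieldType) (L : vectType K).
Variables (br : {bilinear L -> L -> L}) (B : {biscalar L}).

Definition form_symmetric : Prop := forall u v, B u v = B v u.

Definition form_invariant : Prop := forall u v w, B (br u v) w = B u (br v w).

Definition nondegenerate_on (U : {vspace L}) : Prop :=
  forall u, u \in U -> (forall v, v \in U -> B u v = 0) -> u = 0.

(* It suffices to test against a basis: see memv_form_ker. *)
Definition form_ker : {vspace L} :=
  (\bigcap_(i < \dim {:L}) lker (linfun (fun u => B u (vbasis {:L})`_i : K^o)))%VS.

End Forms.

(* The form with Gram matrix G in the basis X. *)
Section GramForm.
Variables (K : fieldType) (L : vectType K) (n : nat).

Definition gram_form (X : n.-tuple L) (G : 'M[K]_n) (u v : L) : K :=
  \sum_(i < n) \sum_(j < n) coord X i u * G i j * coord X j v.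

Fact gram_form_is_bilinear X G : bilinear_for *%R *%R (gram_form X G).
Proof.
split=> w k u v; rewrite /gram_form /= mulr_sumr -big_split /=;
  apply: eq_bigr => i _; rewrite mulr_sumr -big_split /=;
  apply: eq_bigr => j _; rewrite linearP /=.
  by rewrite !mulrDl !mulrA.
by rewrite mulrDr; congr (_ + _); rewrite mulrCA.
Qed.

HB.instance Definition _ X G := bilinear_isBilinear.Build K L L K *%R *%R
  (gram_form X G) (gram_form_is_bilinear X G).

End GramForm.

Lemma memv_form_ker (K : fieldType) (L : vectType K) (B : {biscalar L}) u :
  u \in form_ker B <-> forall v, B u v = 0.
Proof.
have lE i : linfun (fun w => B w (vbasis {:L})`_i : K^o) u
            = B u (vbasis {:L})`_i.
  have lin : linear (fun w => B w (vbasis {:L})`_i : K^o).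
    by move=> k a b; rewrite linearPl.
  pose m := GRing.isLinear.Build K L K^o _ _ lin.
  pose f : {linear L -> K^o} := HB.pack (fun w => B w (vbasis {:L})`_i : K^o) m.
  exact: (lfunE f u).
split=> [/subv_bigcapP uK v | uK].
  rewrite (coord_vbasis (memvf v)) linear_sumr big1 // => i _.
  have := uK i isT; rewrite -memvE memv_ker lE => /eqP uK0.
  by rewrite linearZr_LR /= uK0 mulr0.
by apply/subv_bigcapP => i _; rewrite -memvE memv_ker lE uK.
Qed.

(* An algebra together with a bilinear form; quadratic_lie singles out the    *)
(* quadratic Lie algebras.                                                    *)
Record metric_alg (K : fieldType) := MetricAlg {
  mcar : vectType K;
  mbr : {bilinear mcar -> mcar -> mcar};
  mform : {biscalar mcar}
}.

Section MetricAlgebras.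
Variable K : fieldType.
Implicit Types Q : metric_alg K.

Definition quadratic_lie Q : Prop :=
  [/\ lie_bracket (mbr Q), form_symmetric (mform Q),
      form_invariant (mbr Q) (mform Q) & nondegenerate_on (mform Q) fullv].

Definition decomposable Q : Prop :=
  exists I : {vspace mcar Q},
    [/\ I <> 0%VS, I <> fullv, lie_ideal (mbr Q) I
      & nondegenerate_on (mform Q) I].

Definition lie_type Q : nat := \dim {: quotv (lcs (mbr Q) 2)}.

(* Indecomposable nilpotent quadratic of type 3 and nilpotent index 2 or 3. *)
Definition in_class Q : Prop :=
  [/\ quadratic_lie Q, ~ decomposable Q, lie_type Q = 3%N
    & nilindex (mbr Q) 2 \/ nilindex (mbr Q) 3].

Definition isometric Q1 Q2 : Prop :=
  exists f : 'Hom(mcar Q1, mcar Q2),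
    [/\ bijective f, lie_hom (mbr Q1) (mbr Q2) f
      & forall u v, mform Q2 (f u) (f v) = mform Q1 u v].

(* The quotient of Q by an ideal contained in the kernel of its form. *)
Definition quot_metric Q (U : {vspace mcar Q}) : metric_alg K :=
  @MetricAlg K (quotv U) (@quot_bracket K _ (mbr Q) U)
    (@quot_form K _ (mform Q) U).

End MetricAlgebras.

Section FreeNilpotentThree.
Variables (K : fieldType) (N : vectType K) (br : {bilinear N -> N -> N}).
Variable x : 'I_3 -> N.

Let x1 := x 0.
Let x2 := x 1.
Let x3 := x 2.

Definition basis32 : 6.-tuple N :=
  [tuple x1; x2; x3; br x2 x1; br x3 x1; br x3 x2].

Definition basis33 : 14.-tuple N :=
  [tuple x1; x2; x3; br x2 x1; br x3 x1; br x3 x2;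
     br (br x2 x1) x1; br (br x2 x1) x2; br (br x2 x1) x3;
     br (br x3 x1) x1; br (br x3 x1) x2; br (br x3 x1) x3;
     br (br x3 x2) x2; br (br x3 x2) x3].

Definition rows_mx (m n : nat) (rows : seq (seq K)) : 'M[K]_(m, n) :=
  \matrix_(i, j) nth 0 (nth [::] rows i) j.

Definition Cmx : 'M[K]_3 :=
  rows_mx 3 3 [:: [:: 0;  0; 1];
                  [:: 0; -1; 0];
                  [:: 1;  0; 0]].

Definition Aprime (A : 'M[K]_3) : 'M[K]_(3, 8) :=
  let a := A 0 0 in let b := A 0 1 in let c := A 0 2 in
  let d := A 1 1 in let e := A 1 2 in let f := A 2 2 in
  rows_mx 3 8 [:: [::  0;  a; b;  0;  b; d;  c; e];
                  [:: -a;  0; c; -b;  0; e;  0; f];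
                  [:: -b; -c; 0; -d; -e; 0; -f; 0]].

Definition G32 : 'M[K]_6 := (block_mx 0 Cmx Cmx 0 : 'M[K]_(3 + 3)).

Definition G33 (A : 'M[K]_3) : 'M[K]_14 :=
  (block_mx 0                         (row_mx 0 (Aprime A))
            (col_mx 0 (Aprime A)^T)   (block_mx A 0 0 0)
   : 'M[K]_(3 + (3 + 8))).

Definition B32 : {biscalar N} := gram_form basis32 G32.
Definition B33 (A : 'M[K]_3) : {biscalar N} := gram_form basis33 (G33 A).

Definition n32 : metric_alg K := MetricAlg br B32.
Definition n33 (A : 'M[K]_3) : metric_alg K := MetricAlg br (B33 A).
Definition n33_quot (A : 'M[K]_3) : metric_alg K :=
  quot_metric (form_ker (B33 A) : {vspace mcar (n33 A)}).

End FreeNilpotentThree.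

Arguments Cmx {K}.

(* The cofactor matrix, i.e. the transpose of the library's \adj P. *)
Definition Adj (K : fieldType) (n : nat) (P : 'M[K]_n) : 'M[K]_n :=
  \matrix_(i, j) cofactor P i j.

Definition congruent (K : fieldType) (n : nat) (A B : 'M[K]_n) : Prop :=
  exists2 P : 'M[K]_n, P \in unitmx & B = P^T *m A *m P.

Definition sym_rank_ge2 (K : fieldType) (A : 'M[K]_3) : Prop :=
  A^T = A /\ (2 <= \rank A)%N.

(* K is the field of real numbers, up to ring isomorphism. *)
Definition is_reals (K : fieldType) : Prop :=
  exists (R : realType) (f : {rmorphism K -> R}), bijective f.

(* Main.v *)
(* An invariant symmetric form on a Lie algebra of nilpotent index at most 3  *)
(* generated by z_1, z_2, z_3 is determined by the numbers B(z_i, z_j),       *)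
(* B(z_i, [z_j, z_k]) and B([z_i, z_j], [z_k, z_l]); hence so is the isometry *)
(* class of a quadratic algebra, which is the quotient of the free algebra by *)
(* the kernel of its pulled back form.  Writing brackets of combinations of   *)
(* the z_i with the cross product, the data become the Gram matrix of the     *)
(* z_i, a multiple mu of the determinant and a symmetric matrix S on the      *)
(* second exterior power.  If the algebra is indecomposable its centre lies   *)
(* in its square, so adding to the z_i central elements of the square makes   *)
(* them isotropic; if S <> 0, adding elements of the square makes mu = 0, and *)
(* then rank S <= 1 would produce a central generator.  A change P of         *)
(* generators acts on cross products, hence on S = C A C, through Adj P.      *)
(* Every R with det R or - det R a nonzero square is, up to sign, some Adj P. *)

From HB Require Import structures.
Require Import Defs.
From mathcomp Require Import all_boot all_order all_algebra.
From mathcomp Require Import reals.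
From mathcomp Require Import ring.

Set Implicit Arguments.
Unset Strict Implicit.
Unset Printing Implicit Defensive.

Import GRing.Theory.
Local Open Scope ring_scope.

(** The pairings of generators and of their brackets up to degrees (2, 2) are complete invariants
    ([isometric_of_gen_data]): invariance reduces every other pairing to these, and nondegeneracy
    makes the kernel of the map from the free algebra the radical of the pulled back form. The
    pairing of degrees (1, 2) is alternating, hence [mu] times the determinant; the pairing of
    degrees (2, 2) is a symmetric matrix [S] on the exterior square, identified with K^3 by the
    cross product. [presented] records these data for isotropic generators.

    By [in_class_presented], an algebra of the class has data (-1, 0) or (0, S) with S of rank at
    least 2, according to its nilpotent index. These data are realised by the two families
    ([n32_presented], [n33_quot_presented]), whose Gram matrices are read off in an explicit
    [model]. Conversely such data force membership in the class ([presented_in_class2],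
    [presented_in_class3]), the main point being [indecomposable_criterion].

    An isometry is seen through its action P on generators modulo the square, and P acts on S by
    [Adj P] ([cross_mulmx], [presented_change], [isometric_presented_congr]). Since Adj (Adj R) =
    det R . R in dimension 3 ([Adj_Adj]), every R is up to sign a cofactor matrix once det R or its
    opposite is a square, and the sign disappears in a congruence. *)

Lemma ord3P (P : 'I_3 -> Prop) : P 0 -> P 1 -> P 2 -> forall i, P i.
Proof.
move=> P0 P1 P2; case=> [[|[|[|//]]]] lti; [move: P0|move: P1|move: P2];
  by congr P; apply: val_inj.
Qed.

Lemma sum3E (V : nmodType) (F : 'I_3 -> V) :
  \sum_(i < 3) F i = F 0 + F 1 + F 2.
Proof.
rewrite !big_ord_recl big_ord0 addr0 addrA.
by congr (F _ + F _ + F _); apply: val_inj.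
Qed.

(** * The cross product on K^3 as an exterior square *)

Section CrossProduct.
Variable K : fieldType.
Implicit Types (c d e t : 'rV[K]_3) (S P : 'M[K]_3).

Definition vec3 (x y z : K) : 'rV[K]_3 := \row_i nth 0 [:: x; y; z] i.

Lemma vec3E x y z :
  (vec3 x y z 0 0 = x) * (vec3 x y z 0 1 = y) * (vec3 x y z 0 2 = z).
Proof. by rewrite !mxE. Qed.

Lemma row3P c d : c 0 0 = d 0 0 -> c 0 1 = d 0 1 -> c 0 2 = d 0 2 -> c = d.
Proof. by move=> h0 h1 h2; apply/rowP; apply: ord3P. Qed.

Definition cross c d : 'rV[K]_3 :=
  vec3 (c 0 1 * d 0 2 - c 0 2 * d 0 1) (c 0 2 * d 0 0 - c 0 0 * d 0 2)
       (c 0 0 * d 0 1 - c 0 1 * d 0 0).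

Definition dot c d : K := c 0 0 * d 0 0 + c 0 1 * d 0 1 + c 0 2 * d 0 2.

Definition det3 c d e : K := dot c (cross d e).

Definition qform S c d : K := dot (c *m S) d.

Lemma mulmx3E S c j :
  (c *m S) 0 j = c 0 0 * S 0 j + c 0 1 * S 1 j + c 0 2 * S 2 j.
Proof. by rewrite mxE sum3E. Qed.

Lemma crossDl c d e : cross (c + d) e = cross c e + cross d e.
Proof. by apply: row3P; rewrite !(mxE, vec3E) /=; ring. Qed.

Lemma crossDr c d e : cross e (c + d) = cross e c + cross e d.
Proof. by apply: row3P; rewrite !(mxE, vec3E) /=; ring. Qed.

Lemma crossZl k c e : cross (k *: c) e = k *: cross c e.
Proof. by apply: row3P; rewrite !(mxE, vec3E) /=; ring. Qed.

Lemma crossZr k c e : cross e (k *: c) = k *: cross e c.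
Proof. by apply: row3P; rewrite !(mxE, vec3E) /=; ring. Qed.

Lemma cross0l c : cross 0 c = 0.
Proof. by rewrite -(scale0r 0) crossZl !scale0r. Qed.

Lemma cross0r c : cross c 0 = 0.
Proof. by rewrite -(scale0r 0) crossZr !scale0r. Qed.

Lemma crossxx c : cross c c = 0.
Proof. by apply: row3P; rewrite !(mxE, vec3E) /=; ring. Qed.

Lemma cross_cross_l c d e : cross (cross c d) e = dot c e *: d - dot d e *: c.
Proof. by apply: row3P; rewrite !(mxE, vec3E) /= /dot; ring. Qed.

(** Two planes through [c] meet in the line of [c]. The identity converts vanishing cross products
    of elements of a radical into vanishing determinants. *)
Lemma cross_cross_common c d e :
  cross (cross d c) (cross e c) = det3 c d e *: c.
Proof. by apply: row3P; rewrite /det3 /dot !(mxE, vec3E) /=; ring. Qed.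

Lemma det3_rot c d e : det3 c d e = det3 d e c.
Proof. by rewrite /det3 /dot !vec3E; ring. Qed.

Lemma det3_cramer c d e t :
  det3 c d e *: t
  = det3 t d e *: c + det3 c t e *: d + det3 c d t *: e.
Proof. by apply: row3P; rewrite /det3 /dot !(mxE, vec3E) /=; ring. Qed.

Lemma dot0l c : dot 0 c = 0.
Proof. by rewrite /dot !mxE; ring. Qed.

Lemma dot0r c : dot c 0 = 0.
Proof. by rewrite /dot !mxE; ring. Qed.

Lemma cross_vec3 :
  [/\ cross (vec3 0 1 0) (vec3 0 0 1) = vec3 1 0 0,
      cross (vec3 0 0 1) (vec3 1 0 0) = vec3 0 1 0
    & cross (vec3 1 0 0) (vec3 0 1 0) = vec3 0 0 1].
Proof. by split; apply: row3P; rewrite !vec3E; ring. Qed.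

Lemma dot_cross_eq0 c : (forall d e, dot c (cross d e) = 0) -> c = 0.
Proof.
move=> c0; have [E0 E1 E2] := cross_vec3.
apply: row3P; rewrite mxE.
- by have := c0 (vec3 0 1 0) (vec3 0 0 1);
    rewrite E0 /dot !vec3E; apply: etrans; ring.
- by have := c0 (vec3 0 0 1) (vec3 1 0 0);
    rewrite E1 /dot !vec3E; apply: etrans; ring.
- by have := c0 (vec3 1 0 0) (vec3 0 1 0);
    rewrite E2 /dot !vec3E; apply: etrans; ring.
Qed.

Lemma cross_cross_eq0 c :
  (forall d e, cross (cross d c) (cross e c) = 0) -> c = 0.
Proof.
move=> c0; have [//|nz_c] := eqVneq c 0; apply: dot_cross_eq0 => d e.
have /eqP := c0 d e; rewrite cross_cross_common.
by rewrite scaler_eq0 (negPf nz_c) orbF => /eqP.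
Qed.

Lemma qform_cross_eq0 S c :
  (forall d e, qform S c (cross d e) = 0) -> c *m S = 0.
Proof. exact: dot_cross_eq0. Qed.

(** Each standard basis vector is a cross product, so decomposable elements determine a form on the
    exterior square. *)
Lemma qform_cross_inj S S' :
  (forall c d e f, qform S (cross c d) (cross e f)
                 = qform S' (cross c d) (cross e f)) -> S = S'.
Proof.
move=> eqS; apply/eqP; rewrite -subr_eq0; apply/eqP/row_matrixP => i.
have crossS c d : cross c d *m (S - S') = 0.
  apply: dot_cross_eq0 => e f.
  have /eqP := eqS c d e f; rewrite -subr_eq0 => /eqP <-.
  by rewrite mulmxBr /qform /dot !mxE; ring.
have [E0 E1 E2] := cross_vec3; rewrite rowE row0.
elim/ord3P: i.
- by rewrite -[RHS](crossS (vec3 0 1 0) (vec3 0 0 1)) E0; congr (_ *m _);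
    apply: row3P; rewrite !mxE.
- by rewrite -[RHS](crossS (vec3 0 0 1) (vec3 1 0 0)) E1; congr (_ *m _);
    apply: row3P; rewrite !mxE.
- by rewrite -[RHS](crossS (vec3 1 0 0) (vec3 0 1 0)) E2; congr (_ *m _);
    apply: row3P; rewrite !mxE.
Qed.

(** The left kernel of [S] is at most a line. The cross product form suits kernels made of cross
    products of commuting elements. *)
Definition rank_ge2 S : Prop :=
  forall c d, c *m S = 0 -> d *m S = 0 -> cross c d = 0.

Lemma rank_ge2P S : (2 <= \rank S)%N <-> rank_ge2 S.
Proof.
split=> [rS c d cS dS | S2].
  have rk1 : (\rank (col_mx c d) <= 1)%N.
    have /mxrankS/leq_trans : (col_mx c d <= kermx S)%MS.
      by apply/sub_kermxP; rewrite mul_col_mx cS dS col_mx0.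
    by apply; rewrite mxrank_ker; case: (\rank S) rS => [|[|[|[|]]]].
  have : kermx (col_mx c d) != 0.
    by rewrite kermx_eq0 /row_free; case: (\rank _) rk1 => [|[|]].
  case/rowV0Pn => v /sub_kermxP; rewrite -[v]hsubmxK mul_row_col.
  set a := lsubmx v; set b := rsubmx v.
  rewrite [a]mx11_scalar [b]mx11_scalar !mul_scalar_mx => vcd nz_v.
  have a0 : a 0 0 *: cross c d = 0.
    rewrite -crossZl -[_ *: c](addrK (b 0 0 *: d)) vcd sub0r.
    by rewrite -scaleNr crossZl crossxx scaler0.
  have b0 : b 0 0 *: cross c d = 0.
    rewrite -crossZr -[_ *: d](addKr (a 0 0 *: c)) vcd addr0.
    by rewrite -scaleNr crossZr crossxx scaler0.
  move/eqP: a0; rewrite scaler_eq0 => /orP[/eqP a0|/eqP//].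
  move/eqP: b0; rewrite scaler_eq0 => /orP[/eqP b0|/eqP//].
  by case/eqP: nz_v; rewrite a0 b0 !raddf0 row_mx0.
rewrite leqNgt; apply/negP => rS.
have : (1 < \rank (kermx S))%N.
  by rewrite mxrank_ker; case: (\rank S) rS => [|[|]].
have := row_base_free (kermx S); have := eq_row_base (kermx S).
move: (row_base _); case: (\rank _) => [|[|r]] // B BE freeB _.
have BS i : row i B *m S = 0.
  by apply/sub_kermxP; apply: submx_trans (row_sub _ _) _; rewrite BE.
(* When the cross product of the two rows vanishes, the double cross product formula is a linear
   relation between them; freeness kills the coefficient of [row 1 B], which is this dot product. *)
have dot0 e : dot (row 0 B) e = 0.
  have := cross_cross_l (row 0 B) (row 1 B) e.
  rewrite (S2 (row 0 B) (row 1 B)) // cross0l => /esym.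
  rewrite !rowE !scalemxAl -mulmxBl -[RHS](mul0mx _ B).
  move/(row_free_inj freeB)/rowP/(_ 1); rewrite !mxE /=.
  by rewrite mulr1 mulr0 subr0.
have /(congr1 (mulmx^~ (pinvmx B))) : row 0 B = 0.
  by apply: dot_cross_eq0.
rewrite mul0mx rowE mulmxKp // => /rowP/(_ 0) /eqP.
by rewrite !mxE /= oner_eq0.
Qed.

Lemma det_mx22 (R : comNzRingType) (M : 'M[R]_2) :
  \det M = M 0 0 * M 1 1 - M 0 1 * M 1 0.
Proof.
rewrite (expand_det_row _ 0) !big_ord_recl big_ord0 /cofactor !det_mx11 !mxE /=.
rewrite expr0 expr1 mul1r mulN1r mulrN addr0.
by congr (_ * M _ _ - M _ _ * M _ _); apply: val_inj.
Qed.

Lemma cofactor3E P :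
  [/\ cofactor P 0 0 = P 1 1 * P 2 2 - P 1 2 * P 2 1,
      cofactor P 0 1 = P 1 2 * P 2 0 - P 1 0 * P 2 2
    & cofactor P 0 2 = P 1 0 * P 2 1 - P 1 1 * P 2 0] /\
  [/\ cofactor P 1 0 = P 0 2 * P 2 1 - P 0 1 * P 2 2,
      cofactor P 1 1 = P 0 0 * P 2 2 - P 0 2 * P 2 0
    & cofactor P 1 2 = P 0 1 * P 2 0 - P 0 0 * P 2 1] /\
  [/\ cofactor P 2 0 = P 0 1 * P 1 2 - P 0 2 * P 1 1,
      cofactor P 2 1 = P 0 2 * P 1 0 - P 0 0 * P 1 2
    & cofactor P 2 2 = P 0 0 * P 1 1 - P 0 1 * P 1 0].
Proof.
have l00 : lift (0 : 'I_3) (0 : 'I_2) = 1 by apply: val_inj.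
have l01 : lift (0 : 'I_3) (1 : 'I_2) = 2 by apply: val_inj.
have l10 : lift (1 : 'I_3) (0 : 'I_2) = 0 by apply: val_inj.
have l11 : lift (1 : 'I_3) (1 : 'I_2) = 2 by apply: val_inj.
have l20 : lift (2 : 'I_3) (0 : 'I_2) = 0 by apply: val_inj.
have l21 : lift (2 : 'I_3) (1 : 'I_2) = 1 by apply: val_inj.
by do ![split]; rewrite /cofactor det_mx22 !mxE ?(l00, l01, l10, l11, l20, l21);
  ring.
Qed.

(** The exterior square of a linear map, read through the cross product, is its cofactor matrix:
    this is where [Adj P] comes from. *)
Lemma cross_mulmx P c d :
  cross (c *m P^T) (d *m P^T) = cross c d *m (Adj P)^T.
Proof.
have [[a00 a01 a02] [[a10 a11 a12] [a20 a21 a22]]] := cofactor3E P.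
apply: row3P; rewrite [RHS]mulmx3E /cross !vec3E !mulmx3E !mxE.
- by rewrite a00 a01 a02; ring.
- by rewrite a10 a11 a12; ring.
- by rewrite a20 a21 a22; ring.
Qed.

End CrossProduct.

Section Coordinates.
Import VectorInternalTheory.
Variables (K : fieldType) (V : vectType K).
Implicit Types u v : V.

Definition vcoord i u : K := v2r u 0 i.

Lemma vcoordP u v : (forall i, vcoord i u = vcoord i v) -> u = v.
Proof.
move=> uv; apply: (can_inj v2rK).
by apply/rowP => i; apply: uv.
Qed.

Lemma vcoordD i u v : vcoord i (u + v) = vcoord i u + vcoord i v.
Proof. by rewrite /vcoord linearD mxE. Qed.

Lemma vcoordN i u : vcoord i (- u) = - vcoord i u.
Proof. by rewrite /vcoord linearN mxE. Qed.

Lemma vcoordZ i k u : vcoord i (k *: u) = k * vcoord i u.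
Proof. by rewrite /vcoord linearZ mxE. Qed.

Lemma vcoord0 i : vcoord i 0 = 0.
Proof. by rewrite /vcoord linear0 mxE. Qed.

Definition vcoordE := (vcoordD, vcoordN, vcoordZ, vcoord0).

End Coordinates.

(** Vector identities are checked coordinatewise, where [ring] applies. *)
Ltac module_ring := apply: vcoordP => ?; rewrite !vcoordE; ring.

Section Combinations.
Variables (K : fieldType) (V : lmodType K).
Implicit Types (z : 'I_3 -> V) (c d : 'rV[K]_3).

Definition comb z c : V := c 0 0 *: z 0 + c 0 1 *: z 1 + c 0 2 *: z 2.

Lemma combP z k c d : comb z (k *: c + d) = k *: comb z c + comb z d.
Proof.
rewrite /comb !mxE !scalerDl -!scalerA !scalerDr.
by rewrite [RHS]addrACA; congr (_ + _); apply: addrACA.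
Qed.

Lemma comb0 z : comb z 0 = 0.
Proof. by rewrite /comb !mxE !scale0r !addr0. Qed.

Lemma comb_delta z i : comb z (delta_mx 0 i) = z i.
Proof.
by elim/ord3P: i; rewrite /comb !mxE /= !(scale0r, scale1r, addr0, add0r).
Qed.

End Combinations.

Lemma linear_comb (K : fieldType) (V W : lmodType K) (f : {linear V -> W})
    (z : 'I_3 -> V) c :
  f (comb z c) = comb (f \o z) c.
Proof. by rewrite /comb !linearD !linearZ. Qed.

(** * Lower central series and generation modulo the square *)

Section LowerCentralSeries.
Variables (K : fieldType) (L : vectType K) (br : {bilinear L -> L -> L}).
Implicit Types (U V W : {vspace L}) (u v w : L) (z : 'I_3 -> L).

Lemma commv_subP U V W :
  (commv br U V <= W)%VS <->
  forall u v, u \in U -> v \in V -> br u v \in W.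
Proof.
split=> [sub u v uU vV | sub].
  by apply: (subvP sub); apply: memv_commv.
apply/span_subvP => w /allpairsP[[u v] [/= uU vV ->]].
by apply: sub; apply: vbasis_mem.
Qed.

Lemma commv_ind U V (P : L -> Prop) :
  (forall k u v, P u -> P v -> P (k *: u + v)) ->
  (forall u v, u \in U -> v \in V -> P (br u v)) ->
  forall u, u \in commv br U V -> P u.
Proof.
move=> Plin Pbr u; rewrite /commv; set s := [seq _ | _ <- _, _ <- _].
move/(@coord_span _ _ _ (in_tuple s)) => ->.
elim/big_rec: _ => [|i v _ Pv].
  by rewrite -(linear0l br 0); apply: Pbr; apply: mem0v.
apply: Plin => //; have: s`_i \in s by apply: mem_nth.
by case/allpairsP => -[a b] [/= aU bV ->]; apply: Pbr; apply: vbasis_mem.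
Qed.

Lemma lcs2_ind (P : L -> Prop) :
  (forall k u v, P u -> P v -> P (k *: u + v)) ->
  (forall u v, P (br u v)) -> forall u, u \in lcs br 2 -> P u.
Proof. by move=> Plin Pbr; apply: commv_ind. Qed.

Lemma br_lcs2 u v : br u v \in lcs br 2.
Proof. by apply: memv_commv; apply: memvf. Qed.

Lemma lcs3_eq0P :
  lcs br 3 = 0%VS <-> forall u v w, br (br u v) w = 0.
Proof.
split=> [L0 u v w | br0].
  by apply/eqP; rewrite -memv0 -L0 memv_commv ?memvf ?br_lcs2.
apply/eqP; rewrite -subv0; apply/commv_subP => u w uL _; rewrite memv0.
apply/eqP; elim/lcs2_ind: uL => [k a b a0 b0|a b]; last by rewrite br0.
by rewrite linearPl a0 b0 scaler0 addr0.
Qed.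

Lemma lcs4_eq0P :
  lcs br 4 = 0%VS <-> forall a u v w, br (br (br a u) v) w = 0.
Proof.
have br3 u v w : br (br u v) w \in lcs br 3.
  by rewrite memv_commv ?memvf ?br_lcs2.
split=> [L0 a u v w | br0].
  by apply/eqP; rewrite -memv0 -L0 memv_commv ?memvf ?br3.
apply/eqP; rewrite -subv0; apply/commv_subP => t w tL _; rewrite memv0.
apply/eqP; elim/commv_ind: tL => [k a b a0 b0|u v uL _].
  by rewrite linearPl a0 b0 scaler0 addr0.
elim/lcs2_ind: uL => [k a b a0 b0|a b]; last by rewrite br0.
by rewrite !linearPl a0 b0 scaler0 addr0.
Qed.

(** Spanning modulo the square; under nilpotency this amounts to generating the algebra, see
    [gen_words_ind]. *)
Definition generates z : Prop :=
  forall u, exists c, u - comb z c \in lcs br 2.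

Lemma gen_ind z (gz : generates z) : forall P : L -> Prop,
  (forall k u v, P u -> P v -> P (k *: u + v)) ->
  (forall i, P (z i)) -> (forall u v, P (br u v)) -> forall u, P u.
Proof.
move=> P Plin Pz Pbr u; have [c uc] := gz u.
have P0 : P 0 by rewrite -(linear0l br 0).
rewrite -[u](subrK (comb z c)) addrC.
move: (u - _) (lcs2_ind Plin Pbr uc) => v Pv; rewrite /comb -!addrA.
by do 3![apply: (Plin); first exact: Pz].
Qed.

End LowerCentralSeries.

Section LieAlgebra.
Variables (K : fieldType) (L : vectType K) (br : {bilinear L -> L -> L}).
Hypothesis lieL : lie_bracket br.
Implicit Types (u v w a b : L) (z : 'I_3 -> L) (c d e f : 'rV[K]_3).

Lemma brxx u : br u u = 0.
Proof. by case: lieL. Qed.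

Lemma brC u v : br u v = - br v u.
Proof.
apply/eqP; rewrite -addr_eq0; apply/eqP.
by have := brxx (u + v); rewrite linearDl !linearDr !brxx add0r addr0.
Qed.

Lemma jacobi u v w : br (br u v) w = br (br u w) v + br u (br v w).
Proof.
case: lieL => _ /(_ u v w) J.
rewrite [br (br u v) w]brC [br (br u w) v]brC [br u w]brC linearNr opprK.
suff H (x1 x2 x3 : L) : x1 + x2 + x3 = 0 -> - x3 = x2 + x1 by exact: H J.
by rewrite addrC [x1 + x2]addrC => /eqP; rewrite addr_eq0 -eqr_oppLR => /eqP.
Qed.

Lemma nil3_br (nil3 : forall a u v w, br (br (br a u) v) w = 0) u v a b :
  br (br u v) (br a b) = 0.
Proof. by have := jacobi (br u v) a b; rewrite !nil3 add0r => ->. Qed.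

(** Indices are added modulo 3, so that these brackets correspond to the standard basis of K^3 under
    the cross product. *)
Definition cross_gen z : 'I_3 -> L := fun i => br (z (i + 1)) (z (i + 2)).

Lemma cross_genE z :
  [/\ cross_gen z 0 = br (z 1) (z 2), cross_gen z 1 = br (z 2) (z 0)
    & cross_gen z 2 = br (z 0) (z 1)].
Proof. by split; congr (br (z _) (z _)); apply: val_inj. Qed.

Lemma br_comb z c d :
  br (comb z c) (comb z d) = comb (cross_gen z) (cross c d).
Proof.
have [E0 E1 E2] := cross_genE z.
rewrite /comb E0 E1 E2 /cross !vec3E.
rewrite !linearDl !linearDr !linearZl_LR !linearZr_LR /= !brxx.
rewrite [br (z 2) (z 1)]brC [br (z 1) (z 0)]brC [br (z 0) (z 2)]brC.
move: (br (z 0) (z 1)) (br (z 1) (z 2)) (br (z 2) (z 0)) => x01 x12 x20.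
module_ring.
Qed.
End LieAlgebra.

(** * Words and invariant forms when the fourth term of the series vanishes *)

Section ThreeStep.
Variables (K : fieldType) (L : vectType K) (br : {bilinear L -> L -> L}).
Variable z : 'I_3 -> L.
Hypotheses (lieL : lie_bracket br) (nil3 : lcs br 4 = 0%VS).
Hypothesis gen_z : generates br z.
Implicit Types u v w a b : L.

Let br4 a u v w : br (br (br a u) v) w = 0.
Proof. exact: (proj1 (lcs4_eq0P br) nil3). Qed.

Let brbr u v a b : br (br u v) (br a b) = 0.
Proof. exact: nil3_br. Qed.

(** Replacing a letter of a triple word by a bracket gives degree at least 4, hence 0; so
    left-normed words of length at most 3 in the generators span. *)
Lemma gen_words_ind : forall P : L -> Prop,
  (forall k u v, P u -> P v -> P (k *: u + v)) ->
  (forall i, P (z i)) -> (forall i j, P (br (z i) (z j))) ->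
  (forall i j k, P (br (br (z i) (z j)) (z k))) -> forall u, P u.
Proof.
move=> P Plin P1 P2 P3.
have P0 : P 0 by rewrite -[0](addNr (z 0)) -scaleN1r; apply: Plin.
have PN u : P u -> P (- u) by rewrite -[- u]addr0 -scaleN1r => Pu; apply: Plin.
have P3' u v w : P (br (br u v) w).
  elim/(gen_ind gen_z): w => [k a b||]; first by rewrite linearPr; apply: Plin.
    move=> k; elim/(gen_ind gen_z): u v.
    - by move=> c a b Pa Pb v; rewrite !linearPl; apply: Plin.
    - move=> i v; elim/(gen_ind gen_z): v => [c a b Pa Pb|//|a b].
        by rewrite linearPr linearPl; apply: Plin.
      by rewrite (brC lieL (z i)) linearNl br4 oppr0.
    by move=> a b v; rewrite br4.
  by move=> a b; rewrite brbr.
apply: (gen_ind gen_z) => // u v.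
elim/(gen_ind gen_z): u v => [k a b Pa Pb v|i v|a b v] //.
  by rewrite linearPl; apply: Plin.
elim/(gen_ind gen_z): v => [k a b Pa Pb|//|a b].
  by rewrite linearPr; apply: Plin.
by rewrite brC //; apply: PN.
Qed.

(* Words of total degree at least 5 pair to 0, and invariance reduces the     *)
(* pairing of degrees (1, 3) to the pairing of degrees (2, 2).                *)
Lemma invariant_form_eq0 (D : L -> L -> K) :
  (forall k u v w, D (k *: u + v) w = k * D u w + D v w) ->
  (forall u v, D u v = D v u) ->
  (forall u v w, D (br u v) w = D u (br v w)) ->
  (forall i j, D (z i) (z j) = 0) ->
  (forall i j k, D (z i) (br (z j) (z k)) = 0) ->
  (forall i j k l, D (br (z i) (z j)) (br (z k) (z l)) = 0) ->
  forall u v, D u v = 0.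
Proof.
move=> Dl Dsym Dinv D11 D12 D22.
have D0 w : D 0 w = 0.
  by rewrite -[0](addNr 0) -scaleN1r Dl mulN1r addNr.
have DN u w : D (- u) w = - D u w.
  by rewrite -[- u]addr0 -scaleN1r Dl D0 addr0 mulN1r.
have Dlin v k a b : D a v = 0 -> D b v = 0 -> D (k *: a + b) v = 0.
  by move=> a0 b0; rewrite Dl a0 b0 mulr0 addr0.
have D32 a b c d e : D (br (br a b) c) (br d e) = 0.
  by rewrite -Dinv br4 D0.
have DB22 a b c d : D (br a b) (br c d) = 0.
  have red (w : L) : (forall i j, D (br (z i) (z j)) w = 0) ->
      (forall a b c, D (br (br a b) c) w = 0) -> forall a b, D (br a b) w = 0.
    move=> w2 w3 u v; elim/(gen_ind gen_z): u => [k u1 u2 h1 h2|i|u1 u2].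
    - by rewrite linearPl; apply: Dlin.
    - elim/(gen_ind gen_z): v => [k u1 u2 h1 h2|j|u1 u2]; last 2 first.
      + exact: w2.
      + by rewrite brC // DN w3 oppr0.
      by rewrite linearPr; apply: Dlin.
    exact: w3.
  apply: (red) => [i j|a1 b1 c1]; last exact: D32.
  rewrite Dsym; apply: (red) => [k l|a1 b1 c1]; first by rewrite Dsym D22.
  by rewrite D32.
have D2 a b u : D (br a b) u = 0.
  elim/(gen_ind gen_z): u => [k u v h1 h2||].
  - by rewrite Dsym; apply: Dlin; rewrite Dsym.
  - move=> i; have D3 p q r : D (br (br p q) r) (z i) = 0.
      by rewrite Dinv DB22.
    elim/(gen_ind gen_z): a => [k u1 u2 h1 h2|j|u1 u2]; last exact: D3.
      by rewrite linearPl; apply: Dlin.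
    elim/(gen_ind gen_z): b => [k u1 u2 h1 h2|k|u1 u2].
    + by rewrite linearPr; apply: Dlin.
    + by rewrite Dsym D12.
    by rewrite brC // DN D3 oppr0.
  by move=> u v; apply: DB22.
move=> u v; elim/(gen_ind gen_z): u => [k a b h1 h2|i|a b]; last exact: D2.
  exact: Dlin.
rewrite Dsym; elim/(gen_ind gen_z): v => [k a b h1 h2|j|a b]; last exact: D2.
  exact: Dlin.
exact: D11.
Qed.

End ThreeStep.

(** * Isometries from matching data on generators *)

Section SurjectiveHomomorphisms.
Variables (K : fieldType) (N : vectType K) (br : {bilinear N -> N -> N}).

Lemma generated_hom_surj (Q : vectType K) (brQ : {bilinear Q -> Q -> Q}) z
    (phi : 'Hom(N, Q)) (y : 'I_3 -> N) :
  lie_bracket brQ -> lcs brQ 4 = 0%VS -> generates brQ z ->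
  lie_hom br brQ phi -> (forall i, phi (y i) = z i) -> limg phi = fullv.
Proof.
move=> lieQ nilQ gz hphi phiy; apply/eqP; rewrite eqEsubv subvf /=.
apply/subvP => u _; elim/(gen_words_ind lieQ nilQ gz): u => [k u v||i j|i j k].
- by move=> uW vW; rewrite rpredD ?rpredZ.
- by move=> i; rewrite -phiy memv_img ?memvf.
- by rewrite -!phiy -hphi memv_img ?memvf.
- by rewrite -!phiy -!hphi memv_img ?memvf.
Qed.

(** By nondegeneracy both kernels equal the radical of the common pulled back form, so [phi']
    composed with any section of [phi] is a well defined isometry. *)
Lemma isometric_of_pullback (Q Q' : metric_alg K)
    (phi : 'Hom(N, mcar Q)) (phi' : 'Hom(N, mcar Q')) :
  nondegenerate_on (mform Q) fullv -> nondegenerate_on (mform Q') fullv ->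
  limg phi = fullv -> limg phi' = fullv ->
  lie_hom br (mbr Q) phi -> lie_hom br (mbr Q') phi' ->
  (forall u v, mform Q (phi u) (phi v) = mform Q' (phi' u) (phi' v)) ->
  isometric Q Q'.
Proof.
move=> ndQ ndQ' im im' hphi hphi' eqB.
have phiK u : phi (phi^-1%VF u) = u by rewrite limg_lfunVK ?im ?memvf.
have phiK' u : phi' (phi'^-1%VF u) = u by rewrite limg_lfunVK ?im' ?memvf.
have ker u v : phi u = phi v -> phi' u = phi' v.
  move=> /eqP; rewrite -subr_eq0 -linearB => /eqP uv.
  apply/eqP; rewrite -subr_eq0 -linearB.
  apply/eqP/ndQ'; rewrite ?memvf // => w _.
  by rewrite -(phiK' w) -eqB uv linear0l.
have ker' u v : phi' u = phi' v -> phi u = phi v.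
  move=> /eqP; rewrite -subr_eq0 -linearB => /eqP uv.
  apply/eqP; rewrite -subr_eq0 -linearB.
  apply/eqP/ndQ; rewrite ?memvf // => w _.
  by rewrite -(phiK w) eqB uv linear0l.
exists (phi' \o phi^-1)%VF; split.
- exists (phi \o phi'^-1)%VF => u; rewrite !comp_lfunE.
    by rewrite -[RHS]phiK; apply: ker'; rewrite phiK'.
  by rewrite -[RHS]phiK'; apply: ker; rewrite phiK.
- move=> u v; rewrite !comp_lfunE -hphi'; apply: ker.
  by rewrite hphi !phiK.
by move=> u v; rewrite !comp_lfunE -eqB !phiK.
Qed.

End SurjectiveHomomorphisms.

(** The difference of the two forms pulled back to the free algebra is invariant and symmetric and
    vanishes on the data, hence is 0 by [invariant_form_eq0]. *)
Lemma isometric_of_gen_data (K : fieldType) (N : vectType K)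
    (br : {bilinear N -> N -> N}) (y : 'I_3 -> N) (Q Q' : metric_alg K)
    (z : 'I_3 -> mcar Q) (z' : 'I_3 -> mcar Q') :
  free_nilpotent 3 br y -> generates br y ->
  quadratic_lie Q -> lcs (mbr Q) 4 = 0%VS -> generates (mbr Q) z ->
  quadratic_lie Q' -> lcs (mbr Q') 4 = 0%VS -> generates (mbr Q') z' ->
  (forall i j, mform Q (z i) (z j) = mform Q' (z' i) (z' j)) ->
  (forall i j k, mform Q (z i) (mbr Q (z j) (z k))
               = mform Q' (z' i) (mbr Q' (z' j) (z' k))) ->
  (forall i j k l, mform Q (mbr Q (z i) (z j)) (mbr Q (z k) (z l))
                 = mform Q' (mbr Q' (z' i) (z' j)) (mbr Q' (z' k) (z' l))) ->
  isometric Q Q'.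
Proof.
move=> [lieN nilN univ] gy [lieQ symQ invQ ndQ] nilQ gz.
move=> [lieQ' symQ' invQ' ndQ'] nilQ' gz' e11 e12 e22.
have [phi [[hphi phiy] _]] := univ _ _ z lieQ nilQ.
have [phi' [[hphi' phiy'] _]] := univ _ _ z' lieQ' nilQ'.
have im := generated_hom_surj lieQ nilQ gz hphi phiy.
have im' := generated_hom_surj lieQ' nilQ' gz' hphi' phiy'.
apply: (isometric_of_pullback ndQ ndQ' im im' hphi hphi') => u v.
apply/eqP; rewrite -subr_eq0; apply/eqP; move: u v.
pose D u v := mform Q (phi u) (phi v) - mform Q' (phi' u) (phi' v).
apply: (invariant_form_eq0 lieN nilN gy (D := D)); rewrite /D.
- by move=> k u v w; rewrite !linearP !linearPl /=; ring.
- by move=> u v; rewrite symQ symQ'.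
- by move=> u v w; rewrite !hphi !hphi' invQ invQ'.
- by move=> i j; rewrite !phiy !phiy' e11 subrr.
- by move=> i j k; rewrite !hphi !hphi' !phiy !phiy' e12 subrr.
- by move=> i j k l; rewrite !hphi !hphi' !phiy !phiy' e22 subrr.
Qed.

(** * Orthogonality and duality for bilinear forms *)

Section FormRow.
Variables (K : fieldType) (L : vectType K) (B : {biscalar L}).

Definition form_row n (X : n.-tuple L) (u : L) : 'rV[K]_n := \row_i B u X`_i.

Fact form_row_is_linear n (X : n.-tuple L) : linear (form_row X).
Proof. by move=> k u v; apply/rowP => i; rewrite !mxE linearPl. Qed.

HB.instance Definition _ n (X : n.-tuple L) :=
  GRing.isLinear.Build K L 'rV[K]_n _ (form_row X) (form_row_is_linear X).

Definition orthv (U : {vspace L}) : {vspace L} :=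
  lker (linfun (form_row (vbasis U))).

Lemma memv_orthP (U : {vspace L}) u :
  reflect (forall v, v \in U -> B u v = 0) (u \in orthv U).
Proof.
rewrite memv_ker lfunE; apply: (iffP eqP) => [/rowP u0 v vU | u0].
  rewrite (coord_vbasis vU) linear_sumr big1 // => i _.
  by rewrite linearZr_LR /=; have := u0 i; rewrite !mxE => ->; rewrite mulr0.
by apply/rowP => i; rewrite !mxE u0 // vbasis_mem // mem_nth // size_tuple.
Qed.

(** Dimension count: U meets its orthogonal in 0, and the orthogonal, being cut out by dim U
    equations, has codimension at most dim U. *)
Lemma addv_orth (U : {vspace L}) :
  nondegenerate_on B U -> (U + orthv U)%VS = fullv.
Proof.
move=> ndU; apply/eqP; rewrite eqEdim subvf /=.
have UI : (U :&: orthv U = 0)%VS.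
  apply/eqP; rewrite -subv0; apply/subvP => u; rewrite memv_cap memv0.
  by case/andP => uU /memv_orthP uU'; apply/eqP/ndU.
rewrite (dimv_disjoint_sum UI).
have <- := limg_ker_dim (linfun (form_row (vbasis U))) fullv.
rewrite capfv -/(orthv U) addnC leq_add2r.
by apply: leq_trans (dimvS (subvf _)) _; rewrite dimvf dim_matrix mul1r.
Qed.

Lemma riesz (f : L -> K) :
  nondegenerate_on B fullv ->
  (forall k u v, f (k *: u + v) = k * f u + f v) ->
  exists w, forall u, B w u = f u.
Proof.
move=> ndB flin; pose X := vbasis {: L}; pose g := linfun (form_row X).
have g0 : lker g = 0%VS.
  apply/eqP; rewrite -subv0; apply/subvP => u /memv_orthP u0.
  by rewrite memv0; apply/eqP/ndB; rewrite ?memvf.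
have gim : limg g = fullv.
  apply/eqP; rewrite eqEdim subvf /= dimvf dim_matrix mul1r.
  have := limg_ker_dim g fullv; rewrite g0 capv0 dimv0 add0n => ->.
  exact: leqnn.
exists (g^-1%VF (\row_i f X`_i)) => u.
have /rowP gE : g (g^-1%VF (\row_i f X`_i)) = \row_i f X`_i.
  by rewrite limg_lfunVK // gim memvf.
have f0 : f 0 = 0.
  have /eqP := flin 1 0 0; rewrite scaler0 addr0 mul1r.
  by rewrite -subr_eq subrr => /eqP.
rewrite (coord_vbasis (memvf u)) linear_sumr /=.
have fsum (I : Type) (r : seq I) (F : I -> L) (k : I -> K) :
    f (\sum_(i <- r) k i *: F i) = \sum_(i <- r) k i * f (F i).
  by elim: r => [|i r IH]; rewrite ?big_nil // !big_cons flin IH.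
rewrite fsum; apply: eq_bigr => i _; rewrite linearZr_LR /=; congr (_ * _).
by have := gE i; rewrite lfunE !mxE.
Qed.

End FormRow.

(** * Bases modulo the square, the centre, and decompositions *)

Section GeneratorsModuloSquare.
Variables (K : fieldType) (L : vectType K) (br : {bilinear L -> L -> L}).
Variable z : 'I_3 -> L.

Definition indep_mod_lcs2 : Prop :=
  forall c, comb z c \in lcs br 2 -> c = 0.

Hypotheses (gen_z : generates br z) (ind_z : indep_mod_lcs2).

Let X : 3.-tuple (quotv (lcs br 2)) := [tuple piq (lcs br 2) (z i) | i < 3].

Let XE (i : 'I_3) : X`_i = piq (lcs br 2) (z i).
Proof. by rewrite -tnth_nth tnth_mktuple. Qed.

Lemma quot_lcs2_basis : basis_of {: quotv (lcs br 2)} X.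
Proof.
have sumX (c : 'rV[K]_3) :
    \sum_(i < 3) c 0 i *: X`_i = piq (lcs br 2) (comb z c).
  rewrite linear_comb /comb /= sum3E -!XE.
  by congr (_ *: _ + _ *: _ + _ *: _).
rewrite /basis_of; apply/andP; split; last first.
  apply/freeP => k; pose c : 'rV[K]_3 := \row_i k i.
  have -> : \sum_(i < 3) k i *: X`_i = piq (lcs br 2) (comb z c).
    by rewrite -sumX; apply: eq_bigr => i _; rewrite mxE.
  move/eqP; rewrite piq_eq0 => /ind_z/rowP c0 i.
  by have := c0 i; rewrite !mxE.
rewrite eqEsubv subvf /=; apply/subvP => a _; have [c uc] := gen_z (repq a).
have -> : a = piq (lcs br 2) (comb z c).
  by apply/eqP; rewrite -[a in X in X == _]repqK -subr_eq0 -linearB piq_eq0.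
rewrite -sumX rpred_sum // => i _; rewrite rpredZ // memv_span //.
by rewrite mem_nth // size_tuple.
Qed.

(** Represented through [riesz], such a functional is an element orthogonal to the square, hence
    central, with prescribed pairings with the generators. *)
Lemma lcs2_coordinates (a : 'I_3 -> K) :
  exists f : L -> K,
    [/\ forall k u v, f (k *: u + v) = k * f u + f v,
        forall u, u \in lcs br 2 -> f u = 0
      & forall i, f (z i) = a i].
Proof.
exists (fun u => \sum_(i < 3) coord X i (piq (lcs br 2) u) * a i); split.
- move=> k u v; rewrite mulr_sumr -big_split; apply: eq_bigr => i _ /=.
  by rewrite !linearP /= mulrDl mulrA.
- by move=> u; rewrite -piq_eq0 => /eqP ->; rewrite big1 // => i _;
    rewrite linear0 mul0r.
move=> i; rewrite (bigD1 i) //= big1 => [|j ji].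
  by rewrite -XE coord_free ?(basis_free quot_lcs2_basis) // eqxx mul1r addr0.
rewrite -XE coord_free ?(basis_free quot_lcs2_basis) //.
by rewrite eq_sym (negPf ji) mul0r.
Qed.

End GeneratorsModuloSquare.

Section TypeThree.
Variable K : fieldType.
Implicit Types Q : metric_alg K.

Lemma lie_type3 Q (z : 'I_3 -> mcar Q) :
  generates (mbr Q) z -> indep_mod_lcs2 (mbr Q) z -> lie_type Q = 3%N.
Proof. by move=> gz iz; apply: size_basis (quot_lcs2_basis gz iz). Qed.

Lemma lie_type3_generators Q : lie_type Q = 3%N ->
  exists2 z : 'I_3 -> mcar Q, generates (mbr Q) z & indep_mod_lcs2 (mbr Q) z.
Proof.
rewrite /lie_type => dim3; pose X := vbasis {: quotv (lcs (mbr Q) 2)}.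
pose z (i : 'I_3) := repq X`_i.
have sumX (c : 'rV[K]_3) : piq (lcs (mbr Q) 2) (comb z c)
    = \sum_(i < 3) c 0 i *: X`_i.
  by rewrite linear_comb sum3E /comb /= !repqK.
exists z.
- move=> u; exists (\row_i coord X (cast_ord (esym dim3) i) (piq _ u)).
  rewrite -piq_eq0 linearB /= subr_eq0 sumX.
  rewrite {1}(coord_vbasis (memvf (piq _ u))).
  rewrite (reindex (cast_ord (esym dim3))) /=; last first.
    by exists (cast_ord dim3) => i _; rewrite ?cast_ordK ?cast_ordKV.
  by apply/eqP/eq_bigr => i _; rewrite mxE.
move=> c; rewrite -piq_eq0 sumX => /eqP sum0.
have /freeP := basis_free (vbasisP {: quotv (lcs (mbr Q) 2)}).
move/(_ (fun i => c 0 (cast_ord dim3 i))) => c0.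
apply/rowP => i; rewrite -[i](cast_ordKV dim3) mxE; apply: c0.
rewrite -[RHS]sum0 (reindex (cast_ord (esym dim3))) /=; last first.
  by exists (cast_ord dim3) => j _; rewrite ?cast_ordK ?cast_ordKV.
by apply: eq_bigr => j _; rewrite cast_ordKV.
Qed.

(** Invariance moves [w, u] paired with v to w paired with [u, v]. With the converse below, the
    centre is the orthogonal of the square. *)
Lemma orth_lcs2_central Q w : quadratic_lie Q ->
  (forall u, u \in lcs (mbr Q) 2 -> mform Q w u = 0) ->
  forall u, mbr Q w u = 0.
Proof.
move=> [_ _ invQ ndQ] w0 u; apply: ndQ; first exact: memvf.
by move=> v _; rewrite invQ w0 // br_lcs2.
Qed.

Lemma central_orth_lcs2 Q w : quadratic_lie Q ->
  (forall u, mbr Q w u = 0) ->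
  forall u, u \in lcs (mbr Q) 2 -> mform Q w u = 0.
Proof.
move=> [_ _ invQ _] w0 u uL; elim/lcs2_ind: uL => [k a b a0 b0|a b].
  by rewrite linearPr a0 b0 mulr0 addr0.
by rewrite -invQ w0 linear0l.
Qed.

(* The square is the orthogonal of the centre.  A central element outside the *)
(* square thus pairs nontrivially with a central one, so that some central    *)
(* element spans a nondegenerate line, which splits off.                      *)
Lemma central_in_lcs2 Q u : (2 : K) != 0 ->
  quadratic_lie Q -> ~ decomposable Q -> lie_type Q = 3%N ->
  (forall v, mbr Q u v = 0) -> u \in lcs (mbr Q) 2.
Proof.
move=> nz2 qQ ndecQ type3 u0; have [lieQ symQ invQ ndQ] := qQ.
apply/negPn/negP => uQ.
have norm0 g : (forall v, mbr Q g v = 0) -> mform Q g g = 0.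
  move=> g0; apply/eqP/negPn/negP => gg; apply: ndecQ; exists <[g]>%VS; split.
  - move=> /eqP; rewrite -subv0 -memvE memv0 => /eqP g00.
    by rewrite g00 linear0l eqxx in gg.
  - move=> gfull; move: type3; rewrite /lie_type.
    have : (\dim (lcs (mbr Q) 2)^C <= 1)%N.
      apply: leq_trans (dimvS (subvf _)) _; rewrite -gfull dim_vline.
      by case: (_ == _).
    by rewrite dimvf /dim /= => le1 eq3; rewrite eq3 in le1.
  - by move=> x v /vlineP[k ->]; rewrite linearZl_LR /= g0 scaler0 mem0v.
  move=> x /vlineP[k ->] /(_ g (memv_line g)) /eqP.
  rewrite linearZl_LR /= mulf_eq0 (negPf gg) orbF => /eqP ->.
  by rewrite scale0r.
have [z gz iz] := lie_type3_generators type3.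
have [c uc] := gz u.
have nz_c : c != 0.
  apply: contraNneq uQ => c0.
  by rewrite c0 comb0 subr0 in uc.
have [i ci] : exists i, c 0 i != 0.
  apply/existsP; rewrite -negb_forall; apply: contra nz_c => /forallP c0.
  by apply/eqP/rowP => i; rewrite mxE; apply/eqP.
have [f [flin f0 fz]] := lcs2_coordinates gz iz (fun j => (j == i)%:R).
have [w wf] := riesz ndQ flin.
have w0 v : mbr Q w v = 0.
  by apply: orth_lcs2_central => // x xL; rewrite wf f0.
have : mform Q w u = c 0 i.
  rewrite -[u](subrK (comb z c)) linearDr /= !wf f0 // add0r.
  rewrite -wf /comb !linearDr !linearZr_LR /= !wf !fz.
  elim/ord3P: i {ci f fz f0 flin wf} => /=; ring.
move=> wuc; have : mform Q (w + u) (w + u) = 0.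
  by apply: norm0 => v; rewrite linearDl /= w0 u0 addr0.
rewrite linearDl !linearDr /= norm0 // norm0 // (symQ u w) add0r addr0.
move/eqP; rewrite -mulr2n wuc -mulr_natl mulf_eq0 (negPf nz2).
by rewrite (negPf ci).
Qed.

(* The predicate [rad] stands for the kernel of the form induced on cross     *)
(* products, i.e. on the second exterior power of the space of generators.    *)
(* In a splitting I + J, the commuting summands have cross products in rad,   *)
(* so the mixed terms in the expansion of det (e_1, e_2, e_3) = 1 vanish;     *)
(* then one summand fills the space of generators, so the other lies in the   *)
(* square, is central, and must be 0.                                         *)
Lemma indecomposable_criterion Q (z : 'I_3 -> mcar Q)
    (rad : 'rV[K]_3 -> Prop) :
  quadratic_lie Q -> lcs (mbr Q) 4 = 0%VS -> generates (mbr Q) z ->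
  (forall a b c d, a - comb z c \in lcs (mbr Q) 2 ->
     b - comb z d \in lcs (mbr Q) 2 -> mbr Q a b = 0 -> rad (cross c d)) ->
  (forall s t, rad s -> rad t -> cross s t = 0) ->
  ~ decomposable Q.
Proof.
move=> qQ nilQ gz rad_br rad_cross [I [nzI nfI idI ndI]].
have [lieQ symQ invQ ndQ] := qQ.
pose J := orthv (mform Q) I; have IJ : (I + J)%VS = fullv by apply: addv_orth.
have BIJ i j : i \in I -> j \in J -> mform Q i j = 0.
  by move=> iI /memv_orthP jJ; rewrite symQ jJ.
have brIJ i j : i \in I -> j \in J -> mbr Q i j = 0.
  move=> iI jJ; apply: ndI => [|v vI]; first exact: idI.
  by rewrite brC // linearNl /= invQ symQ BIJ ?oppr0 // idI.
pose lev c a := a - comb z c \in lcs (mbr Q) 2.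
have det0 (U V : {vspace mcar Q}) :
    (forall u v, u \in U -> v \in V -> mbr Q u v = 0) ->
    forall a b u c d e, a \in U -> b \in U -> u \in V ->
    lev c a -> lev d b -> lev e u -> det3 e c d = 0.
  move=> UV a b u c d e aU bU uV ac bd ue.
  have : cross (cross c e) (cross d e) = 0.
    by apply: rad_cross; [apply: (rad_br a u)|apply: (rad_br b u)] => //;
      apply: UV.
  rewrite cross_cross_common => /eqP.
  rewrite scaler_eq0 => /orP[/eqP//|/eqP ->].
  by rewrite /det3 dot0l.
have in_lcs2 (U V : {vspace mcar Q}) : (U + V)%VS = fullv ->
    (forall u v, u \in U -> v \in V -> mform Q u v = 0) ->
    (forall u v, u \in U -> v \in V -> mbr Q u v = 0) ->
    (U <= lcs (mbr Q) 2)%VS -> U = 0%VS.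
  move=> UV formUV brUV UL; apply/eqP; rewrite -subv0; apply/subvP => u uU.
  have brU v : mbr Q u v = 0.
    have /memv_addP[a aU [b bV ->]] : v \in (U + V)%VS by rewrite UV memvf.
    rewrite linearDr /= (brUV _ _ uU bV) addr0.
    have aL := subvP UL _ aU; have uL := subvP UL _ uU.
    elim/lcs2_ind: aL => [k a1 a2 h1 h2|a1 a2].
      by rewrite linearPr h1 h2 scaler0 addr0.
    elim/lcs2_ind: uL => [k u1 u2 h1 h2|u1 u2].
      by rewrite linearPl h1 h2 scaler0 addr0.
    by apply: nil3_br => //; apply/lcs4_eq0P.
  rewrite memv0; apply/eqP/ndQ; rewrite ?memvf // => v _.
  have /memv_addP[a aU [b bV ->]] : v \in (U + V)%VS by rewrite UV memvf.
  rewrite linearDr /= (formUV _ _ uU bV) addr0.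
  by apply: central_orth_lcs2 => //; apply: (subvP UL).
have brJI u v : u \in J -> v \in I -> mbr Q u v = 0.
  by move=> uJ vI; rewrite brC // brIJ // oppr0.
have formJI u v : u \in J -> v \in I -> mform Q u v = 0.
  by move=> uJ vI; rewrite symQ BIJ.
have split_gen k : exists a b c d, [/\ a \in I, b \in J, lev c a, lev d b
    & c + d = delta_mx 0 k].
  have /memv_addP[a aI [b bJ zab]] : z k \in (I + J)%VS by rewrite IJ memvf.
  have [c ac] := gz a; exists a, b, c, (delta_mx 0 k - c); split=> //.
    rewrite /lev -[- c]scaleN1r [delta_mx 0 k + _]addrC combP comb_delta zab.
    have -> : b - (-1 *: comb z c + (a + b)) = -1 *: (a - comb z c).
      by module_ring.
    exact: rpredZ.
  by rewrite addrC subrK.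
have full_lcs2 (U V : {vspace mcar Q}) :
    (forall u v, u \in U -> v \in V -> mbr Q u v = 0) ->
    forall a1 a2 a3 c1 c2 c3, a1 \in U -> a2 \in U -> a3 \in U ->
    lev c1 a1 -> lev c2 a2 -> lev c3 a3 -> det3 c1 c2 c3 != 0 ->
    (V <= lcs (mbr Q) 2)%VS.
  move=> UV a1 a2 a3 c1 c2 c3 U1 U2 U3 h1 h2 h3 nz.
  apply/subvP => v vV; have [e ve] := gz v.
  have := det3_cramer c1 c2 c3 e.
  have -> : det3 e c2 c3 = 0 by apply: (det0 U V UV a2 a3 v).
  have -> : det3 c1 e c3 = 0.
    by rewrite det3_rot; apply: (det0 U V UV a3 a1 v).
  have -> : det3 c1 c2 e = 0.
    by rewrite -det3_rot; apply: (det0 U V UV a1 a2 v).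
  rewrite !scale0r !addr0 => /eqP.
  rewrite scaler_eq0 (negPf nz) => /eqP e0.
  by rewrite e0 comb0 subr0 in ve.
have [a0 [b0 [c0 [d0 [aI0 bJ0 ac0 bd0 e0]]]]] := split_gen 0.
have [a1 [b1 [c1 [d1 [aI1 bJ1 ac1 bd1 e1]]]]] := split_gen 1.
have [a2 [b2 [c2 [d2 [aI2 bJ2 ac2 bd2 e2]]]]] := split_gen 2.
have : det3 (c0 + d0) (c1 + d1) (c2 + d2) = 1.
  by rewrite e0 e1 e2 /det3 /dot !vec3E !mxE /=; ring.
have m0 := det0 _ _ brIJ; have m1 := det0 _ _ brJI.
have -> : det3 (c0 + d0) (c1 + d1) (c2 + d2)
  = det3 c0 c1 c2 + det3 d0 d1 d2
    + (det3 d0 c1 c2 + det3 d1 c2 c0 + det3 d2 c0 c1)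
    + (det3 c0 d1 d2 + det3 c1 d2 d0 + det3 c2 d0 d1).
  by rewrite /det3 /dot !(vec3E, mxE); ring.
rewrite (m0 a1 a2 b0 c1 c2 d0) // (m0 a2 a0 b1 c2 c0 d1) //.
rewrite (m0 a0 a1 b2 c0 c1 d2) //.
rewrite (m1 b1 b2 a0 d1 d2 c0) // (m1 b2 b0 a1 d2 d0 c1) //.
rewrite (m1 b0 b1 a2 d0 d1 c2) //.
rewrite !addr0.
have [-> | detc _] := eqVneq (det3 c0 c1 c2) 0.
  rewrite add0r => detd; apply: nzI; apply: (in_lcs2 I J) => //.
  apply: (full_lcs2 J I brJI b0 b1 b2 d0 d1 d2) => //.
  by rewrite detd oner_eq0.
apply: nfI; rewrite -IJ (in_lcs2 J I) ?addv0 // 1?addvC //.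
exact: (full_lcs2 I J brIJ a0 a1 a2 c0 c1 c2).
Qed.

End TypeThree.

(** * Algebras presented by a scalar [mu] and a matrix [S] *)

Section GramData.
Variable K : fieldType.
Implicit Types (Q : metric_alg K) (S P : 'M[K]_3).

(** The normal form: (mu, S) is (-1, 0) in family (i) and (0, C A C) in family (ii). *)
Record presented Q (z : 'I_3 -> mcar Q) (mu : K) S : Prop := Presented {
  presented_quadratic : quadratic_lie Q;
  presented_nil : lcs (mbr Q) 4 = 0%VS;
  presented_gen : generates (mbr Q) z;
  presented11 : forall c d, mform Q (comb z c) (comb z d) = 0;
  presented12 : forall c d e,
    mform Q (comb z c) (mbr Q (comb z d) (comb z e)) = mu * det3 c d e;
  presented22 : forall c d e f,
    mform Q (mbr Q (comb z c) (comb z d)) (mbr Q (comb z e) (comb z f))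
    = qform S (cross c d) (cross e f)
}.

Lemma isometric_of_presented (N : vectType K) (br : {bilinear N -> N -> N})
    (y : 'I_3 -> N) Q Q' (z : 'I_3 -> mcar Q) (z' : 'I_3 -> mcar Q') mu S :
  free_nilpotent 3 br y -> generates br y ->
  presented z mu S -> presented z' mu S -> isometric Q Q'.
Proof.
move=> freeN gy [qQ nQ gz h11 h12 h22] [qQ' nQ' gz' h11' h12' h22'].
apply: (isometric_of_gen_data freeN gy qQ nQ gz qQ' nQ' gz')
  => [i j|i j k|i j k l].
- by rewrite -(comb_delta z i) -(comb_delta z j) -(comb_delta z' i)
     -(comb_delta z' j) h11 h11'.
- by rewrite -(comb_delta z i) -(comb_delta z j) -(comb_delta z k)
     -(comb_delta z' i) -(comb_delta z' j) -(comb_delta z' k) h12 h12'.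
- by rewrite -(comb_delta z i) -(comb_delta z j) -(comb_delta z k)
     -(comb_delta z l) -(comb_delta z' i) -(comb_delta z' j)
     -(comb_delta z' k) -(comb_delta z' l) h22 h22'.
Qed.

Section Nilpotent.
Variable Q : metric_alg K.
Hypotheses (qQ : quadratic_lie Q) (nilQ : lcs (mbr Q) 4 = 0%VS).

Let lieQ : lie_bracket (mbr Q). Proof. by case: qQ. Qed.

Lemma form_br_lcs2 n b u v :
  n \in lcs (mbr Q) 2 -> mform Q (mbr Q n b) (mbr Q u v) = 0.
Proof.
case: qQ => _ _ invQ _ nL; rewrite invQ.
elim/lcs2_ind: nL => [k n1 n2 h1 h2|n1 n2].
  by rewrite linearPl h1 h2 mulr0 addr0.
rewrite -invQ -invQ (proj1 (lcs4_eq0P _)) //.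
by rewrite linear0l.
Qed.

(** Terms of total degree at least 5 pair to 0, so the pairing of brackets descends to the exterior
    square of the generator space. *)
Lemma form_br_mod_lcs2 a a' b b' u u' v v' :
  a - a' \in lcs (mbr Q) 2 -> b - b' \in lcs (mbr Q) 2 ->
  u - u' \in lcs (mbr Q) 2 -> v - v' \in lcs (mbr Q) 2 ->
  mform Q (mbr Q a b) (mbr Q u v) = mform Q (mbr Q a' b') (mbr Q u' v').
Proof.
case: qQ => _ symQ _ _.
have step1 (x x' w s t : mcar Q) : x - x' \in lcs (mbr Q) 2 ->
    mform Q (mbr Q x w) (mbr Q s t) = mform Q (mbr Q x' w) (mbr Q s t).
  move=> xx'; rewrite -[x](subrK x') linearDl linearDl /=.
  by rewrite form_br_lcs2 // add0r.
have step2 (x x' w s t : mcar Q) : x - x' \in lcs (mbr Q) 2 ->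
    mform Q (mbr Q w x) (mbr Q s t) = mform Q (mbr Q w x') (mbr Q s t).
  move=> xx'; rewrite (brC lieQ w x) (brC lieQ w x') !linearNl /=.
  by rewrite (step1 x x').
move=> aa' bb' uu' vv'; rewrite (step1 a a') // (step2 b b') // symQ.
by rewrite (step1 u u') // (step2 v v') // symQ.
Qed.

End Nilpotent.

Section Presented.
Variables (Q : metric_alg K) (z : 'I_3 -> mcar Q) (mu : K) (S : 'M[K]_3).
Hypothesis pQ : presented z mu S.

Let qQ := presented_quadratic pQ.
Let nilQ := presented_nil pQ.
Let gz := presented_gen pQ.

Lemma presented22_mod a b u v c d e f :
  a - comb z c \in lcs (mbr Q) 2 -> b - comb z d \in lcs (mbr Q) 2 ->
  u - comb z e \in lcs (mbr Q) 2 -> v - comb z f \in lcs (mbr Q) 2 ->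
  mform Q (mbr Q a b) (mbr Q u v) = qform S (cross c d) (cross e f).
Proof.
move=> ac bd ue vf; rewrite -(presented22 pQ).
exact: form_br_mod_lcs2.
Qed.

Lemma presented_br_eq0 a b c d :
  a - comb z c \in lcs (mbr Q) 2 -> b - comb z d \in lcs (mbr Q) 2 ->
  mbr Q a b = 0 -> cross c d *m S = 0.
Proof.
move=> ac bd ab0; apply: qform_cross_eq0 => e f.
rewrite -(@presented22_mod a b (comb z e) (comb z f)) ?subrr ?mem0v //.
by rewrite ab0 linear0l.
Qed.

Lemma presented_lcs3_neq0 : rank_ge2 S -> lcs (mbr Q) 3 <> 0%VS.
Proof.
move=> S2 L3; have [_ _ invQ _] := qQ.
have S0 : S = 0.
  apply: qform_cross_inj => c d e f.
  rewrite -(presented22 pQ) -invQ (proj1 (lcs3_eq0P _) L3) linear0l /qform.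
  by rewrite mulmx0 dot0l.
have [_ _ E2] := cross_vec3 K.
have /rowP/(_ 2) : cross (vec3 1 0 0) (vec3 0 1 0) = 0 :> 'rV[K]_3.
  by apply: S2; rewrite S0 mulmx0.
by move/eqP; rewrite E2 vec3E mxE oner_eq0.
Qed.

Lemma presented_in_class3 : rank_ge2 S -> in_class Q.
Proof.
(* If [comb z c] lies in the square, all cross products with [c] lie in the kernel of [S]; being
   pairwise proportional, they force c = 0 by [cross_cross_eq0]. *)
move=> S2; have iz : indep_mod_lcs2 (mbr Q) z.
  move=> c cL; apply: cross_cross_eq0 => d e.
  have rad_c f : cross f c *m S = 0.
    apply: qform_cross_eq0 => s t.
    rewrite -(@presented22_mod (comb z f) 0 (comb z s) (comb z t))
      ?subrr ?mem0v //.
      by rewrite linear0r linear0l.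
    by rewrite sub0r rpredN.
  exact: S2.
split=> //.
- apply: (indecomposable_criterion (rad := fun s => s *m S = 0) qQ nilQ gz).
  + exact: presented_br_eq0.
  exact: S2.
- exact: lie_type3 gz iz.
right; split=> //; apply/eqP/presented_lcs3_neq0.
exact: S2.
Qed.

Lemma presented_in_class2 : lcs (mbr Q) 3 = 0%VS -> mu != 0 -> in_class Q.
Proof.
move=> L3 nz_mu; have br3 := proj1 (lcs3_eq0P _) L3.
have [lieQ symQ invQ ndQ] := qQ.
have brL n b : n \in lcs (mbr Q) 2 -> mbr Q n b = 0.
  move=> nL; elim/lcs2_ind: nL => [k n1 n2 h1 h2|n1 n2]; last exact: br3.
  by rewrite linearPl h1 h2 scaler0 addr0.
have iz : indep_mod_lcs2 (mbr Q) z.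
  move=> c cL; apply: dot_cross_eq0 => d e.
  have := presented12 pQ c d e.
  rewrite -invQ brL // linear0l => /esym/eqP.
  by rewrite mulf_eq0 (negPf nz_mu) => /eqP.
split=> //.
(* Here [mu] detects commutation: if [a, b] = 0, then c x d is orthogonal to every cross product e x
   f, because the determinant of (e x f, c, d) vanishes. *)
- apply: (indecomposable_criterion (rad := fun s => s = 0) qQ nilQ gz) => //.
    move=> a b c d ac bd ab0; apply: dot_cross_eq0 => e f.
    have br_cd : mbr Q (comb z c) (comb z d) = 0.
      have brE u v w : u - v \in lcs (mbr Q) 2 -> mbr Q v w = mbr Q u w.
        by move=> uv; apply/esym/eqP; rewrite -subr_eq0 -linearBl /= brL.
      by rewrite (brE a) // brC // (brE b) // brC // opprK ab0.
    have /eqP := presented12 pQ (cross e f) c d.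
    rewrite br_cd linear0r eq_sym mulf_eq0 (negPf nz_mu) /= => /eqP <-.
    by rewrite /det3 /dot; ring.
  by move=> s t -> _; rewrite cross0l.
- exact: lie_type3 gz iz.
left; split=> //; apply/eqP => L2.
have := presented12 pQ (vec3 1 0 0) (vec3 0 1 0) (vec3 0 0 1).
have -> : mbr Q (comb z (vec3 0 1 0)) (comb z (vec3 0 0 1)) = 0.
  by apply/eqP; rewrite -memv0 -L2 br_lcs2.
rewrite linear0r /det3 /dot !vec3E => /esym/eqP.
rewrite mulf_eq0 (negPf nz_mu) /= => /eqP det0.
by have /eqP := oner_eq0 K; apply; rewrite -det0; ring.
Qed.

End Presented.

Lemma comb_mulmx (V : vectType K) (z : 'I_3 -> V) P c :
  comb (fun j => comb z (row j P)) c = comb z (c *m P).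
Proof. by rewrite {1 3}/comb !mulmx3E /comb !mxE; module_ring. Qed.

Lemma dot_mulmx (s t : 'rV[K]_3) M : dot s (t *m M^T) = dot (s *m M) t.
Proof. by rewrite /dot !mulmx3E !mxE; ring. Qed.

Lemma presented_change Q (z : 'I_3 -> mcar Q) S P :
  presented z 0 S -> P \in unitmx ->
  presented (fun j => comb z (row j P^T)) 0 ((Adj P)^T *m S *m Adj P).
Proof.
case=> qQ nQ gz h11 h12 h22 uP; split=> //.
- move=> u; have [c uc] := gz u; exists (c *m invmx P^T).
  by rewrite comb_mulmx mulmxKV // unitmx_tr.
- by move=> c d; rewrite !comb_mulmx.
- by move=> c d e; rewrite !comb_mulmx h12 !mul0r.
- move=> c d e f; rewrite !comb_mulmx h22 !cross_mulmx /qform.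
  by rewrite dot_mulmx !mulmxA.
Qed.

(** Pull [z'] back along the isometry and let the rows of R be its coordinates in [z] modulo the
    square; the pairing of degrees (2, 2) sees nothing else, and P is the transpose of R. *)
Lemma isometric_presented_congr Q Q' (z : 'I_3 -> mcar Q) (z' : 'I_3 -> mcar Q')
    S S' :
  presented z 0 S -> presented z' 0 S' -> rank_ge2 S' -> isometric Q Q' ->
  exists2 P, P \in unitmx & S' = (Adj P)^T *m S *m Adj P.
Proof.
move=> pQ pQ' S2 [f [[g fK gK] hf isof]].
pose t i := g (z' i); have ft i : f (t i) = z' i by rewrite /t gK.
have [p tp] : exists p : 'I_3 -> 'rV[K]_3,
    forall i, t i - comb z (p i) \in lcs (mbr Q) 2.
  have [p0 tp0] := presented_gen pQ (t 0).
  have [p1 tp1] := presented_gen pQ (t 1).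
  have [p2 tp2] := presented_gen pQ (t 2).
  by exists (tnth [tuple p0; p1; p2]); apply: ord3P.
pose R : 'M[K]_3 := \matrix_i p i.
have tR c : comb t c - comb z (c *m R) \in lcs (mbr Q) 2.
  rewrite -comb_mulmx /comb !rowK.
  have -> : c 0 0 *: t 0 + c 0 1 *: t 1 + c 0 2 *: t 2
    - (c 0 0 *: comb z (p 0) + c 0 1 *: comb z (p 1) + c 0 2 *: comb z (p 2))
    = c 0 0 *: (t 0 - comb z (p 0)) + c 0 1 *: (t 1 - comb z (p 1))
      + c 0 2 *: (t 2 - comb z (p 2)).
    by move: (comb z (p 0)) (comb z (p 1)) (comb z (p 2)) => *; module_ring.
  by rewrite !rpredD ?rpredZ.
have fcomb c : f (comb t c) = comb z' c.
  by rewrite linear_comb /comb /= !ft.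
have S'E : S' = (Adj R^T)^T *m S *m Adj R^T.
  apply: qform_cross_inj => c d e h.
  rewrite -(presented22 pQ') -!fcomb -!hf isof.
  rewrite (presented22_mod pQ (tR c) (tR d) (tR e) (tR h)).
  by rewrite -[R]trmxK !cross_mulmx /qform dot_mulmx !mulmxA !trmxK.
(* Invertibility comes from the rank of [S']: if c R = 0, every h x c is killed by [S'], whence c =
   0. *)
exists R^T => //; rewrite unitmx_tr -row_free_unit -kermx_eq0.
apply/rowV0P => c /sub_kermxP cR0; apply: cross_cross_eq0 => d e.
have rad_c h : cross h c *m S' = 0.
  rewrite S'E !mulmxA -cross_mulmx trmxK cR0 cross0r !mul0mx.
  by [].
exact: S2.
Qed.

End GramData.

(** * The free algebras and an explicit model *)

Section FreeGenerated.
Variables (K : fieldType) (N : vectType K) (br : {bilinear N -> N -> N}).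

(* Modulo <x> + [N, N], the projection and 0 are two homomorphisms to an      *)
(* abelian algebra that agree on the generators.                              *)
Lemma free_generates t (x : 'I_3 -> N) : (0 < t)%N ->
  free_nilpotent t br x -> generates br x.
Proof.
move=> t_gt0 [lieN nilN univ].
pose U := (<<[tuple x i | i < 3]>> + lcs br 2)%VS.
have xU i : x i \in U.
  apply: (subvP (addvSl _ _)); apply: memv_span.
  by apply/tnthP; exists i; rewrite tnth_mktuple.
pose brU : {bilinear quotv U -> quotv U -> quotv U} := @quot_bracket K N br U.
have br0 a b : brU a b = 0.
  apply/eqP; rewrite /brU /= /quot_bracket piq_eq0.
  exact: (subvP (addvSr _ _)) (br_lcs2 _ _ _).
have lieU : lie_bracket brU.
  by split=> [u|u v w]; rewrite !br0 ?linear0r ?addr0.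
have nilU : lcs brU t.+1 = 0%VS.
  case: t t_gt0 {nilN univ} => // t _.
  apply/eqP; rewrite -subv0; apply/commv_subP => u v _ _.
  by rewrite br0 mem0v.
have [f [[hf fx] fU]] := univ _ _ (fun=> 0 : quotv U) lieU nilU.
have f1 : f = 0.
  apply: fU; split=> [u v|i]; rewrite lfunE //=.
  by rewrite br0.
have f2 : f = linfun (@piq K N U).
  apply: fU; split=> [u v|i]; rewrite !lfunE /=.
    by rewrite br0; apply/eqP; rewrite piq_eq0 (subvP (addvSr _ _)) ?br_lcs2.
  by apply/eqP; rewrite piq_eq0 xU.
move=> u; have uU : u \in U.
  by rewrite -piq_eq0 -[piq U u]lfunE -f2 f1 lfunE.
have /memv_addP[a aX [b bL ->]] := uU.
have := coord_span aX; set k := coord _ => aE.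
exists (\row_i k i a); rewrite [a in a + b]aE /comb !mxE sum3E.
by rewrite -!tnth_nth !tnth_mktuple [X in X \in _]addrAC subrr add0r.
Qed.

End FreeGenerated.

Section Model.
Variables (K : fieldType) (S : 'M[K]_3).
Hypothesis symS : S^T = S.

(* V + W + V^*, with W the second exterior power of V identified with V by    *)
(* the cross product: <[w, v], v'> = S (w, v x v') for w in W.                *)
Definition model : vectType K := ('rV[K]_3 * 'rV[K]_3 * 'rV[K]_3)%type.
Implicit Types u v w : model.

Lemma model_eqP u v : u.1.1 = v.1.1 -> u.1.2 = v.1.2 -> u.2 = v.2 -> u = v.
Proof. by case: u v => [[? ?] ?] [[? ?] ?] /= -> -> ->. Qed.

Definition model_br u v : model :=
  (0, cross u.1.1 v.1.1,
   cross (u.1.2 *m S) v.1.1 - cross (v.1.2 *m S) u.1.1).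

Fact model_br_is_bilinear : bilinear_for *:%R *:%R model_br.
Proof.
split=> w k u v; apply: model_eqP => /=.
- by rewrite scaler0 addr0.
- by rewrite crossDl crossZl.
- rewrite mulmxDl -scalemxAl crossDl crossDr crossZl crossZr.
  by rewrite scalerBr opprD addrACA.
- by rewrite scaler0 addr0.
- by rewrite crossDr crossZr.
- rewrite mulmxDl -scalemxAl crossDl crossDr crossZl crossZr.
  by rewrite scalerBr opprD addrACA.
Qed.

HB.instance Definition _ := bilinear_isBilinear.Build K
  model model model *:%R *:%R model_br model_br_is_bilinear.

Definition model_form (mu : K) u v : K :=
  dot u.1.1 v.2 + dot u.2 v.1.1 + qform S u.1.2 v.1.2
  + mu * (dot u.1.1 v.1.2 + dot u.1.2 v.1.1).

Let S10 : S 1 0 = S 0 1. Proof. by rewrite -{1}symS mxE. Qed.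
Let S20 : S 2 0 = S 0 2. Proof. by rewrite -{1}symS mxE. Qed.
Let S21 : S 2 1 = S 1 2. Proof. by rewrite -{1}symS mxE. Qed.

(** In the component V^*, the Jacobi identity says that the cyclic sum of S(v x w) x u vanishes,
    which is the symmetry of S. *)
Lemma model_lie : lie_bracket (model_br : {bilinear model -> model -> model}).
Proof.
split=> [u|u v w]; rewrite /= /model_br /=.
  by rewrite crossxx subrr.
apply: model_eqP => /=.
- by rewrite !addr0.
- by rewrite !cross0r !addr0.
by apply: row3P; rewrite !(vec3E, mulmx3E, mxE) /= ?S10 ?S20 ?S21;
  ring.
Qed.

Lemma model_nil : lcs (model_br : {bilinear model -> model -> model}) 4 = 0%VS.
Proof.
apply/lcs4_eq0P => a u v w; apply: model_eqP => //=.
  by rewrite cross0l.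
by rewrite cross0l cross0r mul0mx cross0l subr0.
Qed.

Section ModelForm.
Variable mu : K.

Lemma model_formC u v : model_form mu u v = model_form mu v u.
Proof.
by rewrite /model_form /qform /dot !mulmx3E ?S10 ?S20 ?S21; ring.
Qed.

Lemma model_formP k u v w :
  model_form mu (k *: u + v) w = k * model_form mu u w + model_form mu v w.
Proof. by rewrite /model_form /qform /dot !mulmx3E !mxE; ring. Qed.

Lemma model_formV u v w :
  model_form mu (model_br u v) w = model_form mu u (model_br v w).
Proof.
rewrite /model_form /qform /dot /= !(vec3E, mulmx3E, mxE) /=.
by rewrite ?S10 ?S20 ?S21; ring.
Qed.

End ModelForm.

End Model.

Section GramForm.
Variables (K : fieldType) (L : vectType K) (n : nat).

(* [X] need not be free: [coord X] gives some coordinates as soon as [X]      *)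
(* spans, and these are enough here.                                          *)
Lemma gram_formE (X : n.-tuple L) (G : 'M[K]_n) (F : L -> L -> K) :
  (forall u, u \in <<X>>%VS) ->
  (forall k u v w, F (k *: u + v) w = k * F u w + F v w) ->
  (forall u v, F u v = F v u) ->
  (forall i j : 'I_n, F X`_i X`_j = G i j) ->
  forall u v, gram_form X G u v = F u v.
Proof.
move=> spanX Flin Fsym FX u v.
have F0 w : F 0 w = 0.
  by rewrite -[0](addNr 0) -scaleN1r Flin mulN1r addNr.
have Fsum (k : 'I_n -> K) (f : 'I_n -> L) w :
    F (\sum_i k i *: f i) w = \sum_i k i * F (f i) w.
  elim: (index_enum _) => [|i r IH]; rewrite ?big_nil // !big_cons.
  by rewrite Flin IH.
rewrite {2}(coord_span (spanX u)) Fsum /gram_form; apply: eq_bigr => i _.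
rewrite Fsym {2}(coord_span (spanX v)) Fsum mulr_sumr.
by apply: eq_bigr => j _; rewrite Fsym FX; ring.
Qed.

End GramForm.

Section ModelHomomorphism.
Variables (K : fieldType) (N : vectType K) (br : {bilinear N -> N -> N}).
Variables (x : 'I_3 -> N) (S : 'M[K]_3) (phi : 'Hom(N, model K)) (mu : K).
Hypothesis hphi : lie_hom br (model_br S) phi.
Hypothesis phix : forall i, phi (x i) = (delta_mx 0 i, 0, 0).

Let F u v := model_form S mu (phi u) (phi v).

Lemma model_comb c : phi (comb x c) = (c, 0, 0).
Proof.
rewrite linear_comb /comb /= !phix; apply: model_eqP => /=.
- apply: row3P; rewrite !mxE /=; ring.
- by rewrite !scaler0 !addr0.
by rewrite !scaler0 !addr0.
Qed.

Lemma model_br_comb c d : phi (br (comb x c) (comb x d)) = (0, cross c d, 0).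
Proof.
rewrite hphi !model_comb; apply: model_eqP => //=.
by rewrite !mul0mx !cross0l subrr.
Qed.

Lemma model_gram11 c d : F (comb x c) (comb x d) = 0.
Proof.
rewrite /F !model_comb /model_form /qform /= mul0mx !(dot0l, dot0r); ring.
Qed.

Lemma model_gram12 c d e :
  F (comb x c) (br (comb x d) (comb x e)) = mu * det3 c d e.
Proof.
rewrite /F !model_comb model_br_comb /model_form /qform /=.
by rewrite mul0mx !(dot0l, dot0r) /det3; ring.
Qed.

Lemma model_gram22 c d e f :
  F (br (comb x c) (comb x d)) (br (comb x e) (comb x f))
  = qform S (cross c d) (cross e f).
Proof.
rewrite /F !model_br_comb /model_form /= !(dot0l, dot0r); ring.
Qed.

End ModelHomomorphism.

Section SpanningWords.
Variables (K : fieldType) (N : vectType K) (br : {bilinear N -> N -> N}).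
Variable x : 'I_3 -> N.
Hypotheses (lieN : lie_bracket br) (gen_x : generates br x).

Lemma span_words (U : {vspace N}) : lcs br 4 = 0%VS ->
  (forall i, x i \in U) ->
  br (x 1) (x 0) \in U -> br (x 2) (x 0) \in U -> br (x 2) (x 1) \in U ->
  (forall k, br (br (x 1) (x 0)) (x k) \in U) ->
  (forall k, br (br (x 2) (x 0)) (x k) \in U) ->
  (forall k, br (br (x 2) (x 1)) (x k) \in U) ->
  forall u, u \in U.
Proof.
move=> nil4 U1 w10 w20 w21 t10 t20 t21.
apply: (gen_words_ind lieN nil4 gen_x) => //.
- by move=> k u v uU vU; rewrite rpredD ?rpredZ.
- by do 2![apply: ord3P]; rewrite ?(brxx lieN) ?mem0v //;
    rewrite (brC lieN) rpredN.
by do 2![apply: ord3P] => k; rewrite ?(brxx lieN) ?linear0l ?mem0v //;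
  rewrite (brC lieN (x _) (x _)) linearNl rpredN.
Qed.

Lemma basis33_span : lcs br 4 = 0%VS -> forall u, u \in <<basis33 br x>>%VS.
Proof.
move=> nil4; apply: span_words => //; try apply: ord3P;
  try by apply: memv_span; rewrite /= !inE eqxx ?orbT.
(* The remaining word [[x3, x2], x1] is absent from the list; Jacobi gives it as [[x3, x1], x2] -
   [[x2, x1], x3]. *)
rewrite (jacobi lieN) (brC lieN (x 2) (br _ _)) rpredB //;
  by apply: memv_span; rewrite /= !inE eqxx ?orbT.
Qed.

Lemma basis32_span : lcs br 3 = 0%VS -> forall u, u \in <<basis32 br x>>%VS.
Proof.
move=> nil3; have br3 := proj1 (lcs3_eq0P _) nil3.
apply: span_words => [|i||||k|k|k]; rewrite ?br3 ?mem0v //.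
- by apply/lcs4_eq0P => a u v w; rewrite br3.
- by elim/ord3P: i; apply: memv_span; rewrite /= !inE eqxx ?orbT.
all: by apply: memv_span; rewrite /= !inE eqxx ?orbT.
Qed.

End SpanningWords.

(** * The forms of the two families computed in the model *)

Lemma CmxT (K : fieldType) : Cmx^T = Cmx :> 'M[K]_3.
Proof. by apply/matrixP; do 2![apply: ord3P]; rewrite !mxE. Qed.

Lemma CmxK (K : fieldType) : Cmx *m Cmx = 1%:M :> 'M[K]_3.
Proof.
by apply/matrixP; do 2![apply: ord3P]; rewrite !mxE sum3E !mxE /=; ring.
Qed.

Section Gram33.
Variables (K : fieldType) (N : vectType K) (br : {bilinear N -> N -> N}).
Variables (y : 'I_3 -> N) (A : 'M[K]_3).
Hypotheses (free_y : free_nilpotent 3 br y) (symA : A^T = A).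

(* Since ([x2, x1], [x3, x1], [x3, x2]) is minus the basis of cross products  *)
(* multiplied by C, a Gram matrix A on the former is C A C on the latter.     *)
Definition cross_gram : 'M[K]_3 := Cmx *m A *m Cmx.

Lemma cross_gram_sym : cross_gram^T = cross_gram.
Proof. by rewrite /cross_gram !trmx_mul symA CmxT mulmxA. Qed.

Lemma cross_gramE :
  [/\ cross_gram 0 0 = A 2 2, cross_gram 0 1 = - A 1 2, cross_gram 0 2 = A 0 2
    & [/\ cross_gram 1 1 = A 1 1, cross_gram 1 2 = - A 0 1
        & cross_gram 2 2 = A 0 0]].
Proof.
have A10 : A 1 0 = A 0 1 by rewrite -{1}symA mxE.
have A20 : A 2 0 = A 0 2 by rewrite -{1}symA mxE.
have A21 : A 2 1 = A 1 2 by rewrite -{1}symA mxE.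
by do ![split]; rewrite /cross_gram !mxE !sum3E !mxE !sum3E !mxE /=
  ?A10 ?A20 ?A21; ring.
Qed.

(** The universal property gives a map to the model. The pulled back model form has the entries of
    [G33 A] on the 14 spanning words, so it is [B33], which thereby inherits symmetry and
    invariance. *)
Lemma B33_model : exists phi : 'Hom(N, model K),
  [/\ lie_hom br (model_br cross_gram) phi,
      forall i, phi (y i) = (delta_mx 0 i, 0, 0)
    & forall u v, B33 br y A u v
                = model_form cross_gram 0 (phi u) (phi v)].
Proof.
have [lieN nilN univ] := free_y.
have gy := free_generates (isT : 0 < 3)%N free_y.
have lieM := model_lie cross_gram_sym.
have [phi [[hphi phiy] _]] :=
  univ _ _ (fun i => (delta_mx 0 i, 0, 0) : model K) lieM (model_nil _).
exists phi; split=> //; apply: gram_formE.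
- exact: basis33_span.
- by move=> k u v w; rewrite linearP model_formP.
- by move=> u v; rewrite model_formC //; apply: cross_gram_sym.
pose e (a : 'I_3) : 'rV[K]_3 := delta_mx 0 a.
(* The W components of the images of [x2, x1], [x3, x1], [x3, x2]; [tau] below lists the V^*
   components for the eight triple words. *)
pose omega (b : nat) : 'rV[K]_3 :=
  nth 0 [:: vec3 0 0 (-1); vec3 0 1 0; vec3 (-1) 0 0] b.
pose tau (c : nat) : 'rV[K]_3 :=
  nth 0 [seq cross (omega p.1 *m cross_gram) (e p.2) | p <-
    [:: (0%N, 0); (0%N, 1); (0%N, 2); (1%N, 0); (1%N, 1); (1%N, 2);
        (2%N, 1); (2%N, 2)]] c.
have phi1 (a : 'I_3) : phi (basis33 br y)`_(lshift 11 a) = (e a, 0, 0).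
  by elim/ord3P: a => /=; apply: phiy.
have phi2 (b : 'I_3) :
    phi (basis33 br y)`_(rshift 3 (lshift 8 b)) = (0, omega b, 0).
  elim/ord3P: b => /=; rewrite hphi !phiy; apply: model_eqP => //=;
    rewrite ?mul0mx ?cross0l ?subrr //; apply: row3P;
    rewrite !vec3E !mxE /=; ring.
have phi3 (c : 'I_8) :
    phi (basis33 br y)`_(rshift 3 (rshift 3 c)) = (0, 0, tau c).
  have := phi2 0; have := phi2 1; have := phi2 2 => /= w2 w1 w0.
  by case: c => [] [|[|[|[|[|[|[|[|//]]]]]]]] lt_c /=; rewrite hphi phiy
    ?w0 ?w1 ?w2; apply: model_eqP => //=;
    rewrite ?mul0mx ?cross0l ?cross0r ?subr0.
have symC i j : cross_gram i j = cross_gram j i.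
  by rewrite -{1}cross_gram_sym mxE.
have [c00 c01 c02 [c11 c12 c22]] := cross_gramE.
have cE := (symC 1 0, symC 2 0, symC 2 1, c00, c01, c02, (c11, c12, c22)).
have entry13 a (c : 'I_8) : dot (e a) (tau c) = Aprime A a c.
  elim/ord3P: a; case: c => [] [|[|[|[|[|[|[|[|//]]]]]]]] lt_c;
    rewrite /tau /= /dot /e /omega /= /Aprime [RHS]mxE /=
    !vec3E !mulmx3E !vec3E !cE !mxE /=; ring.
have entry22 (b b' : 'I_3) : qform cross_gram (omega b) (omega b') = A b b'.
  have symA' i j : A i j = A j i by rewrite -{1}symA mxE.
  elim/ord3P: b; elim/ord3P: b';
    rewrite /omega /= /qform /dot !mulmx3E !vec3E !cE
    ?(symA' 1 0) ?(symA' 2 0) ?(symA' 2 1); ring.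
have m0 u v : model_form cross_gram 0 u v
    = dot u.1.1 v.2 + dot u.2 v.1.1 + qform cross_gram u.1.2 v.1.2.
  by rewrite /model_form mul0r addr0.
have trE (B : 'M[K]_(3, 8)) i j : B^T i j = B j i by rewrite mxE.
have q0l v : qform cross_gram 0 v = 0 by rewrite /qform mul0mx dot0l.
have q0r v : qform cross_gram v 0 = 0 by rewrite /qform dot0r.
have zE m n i j : (0 : 'M[K]_(m, n)) i j = 0 by rewrite mxE.
move=> i j; rewrite m0 /G33.
case: (@split_ordP 3 11 i) => [a ->|i' ->];
  [|case: (@split_ordP 3 8 i') => [b ->|c ->]];
(case: (@split_ordP 3 11 j) => [a' ->|j' ->];
  [|case: (@split_ordP 3 8 j') => [b' ->|c' ->]]);
rewrite ?(phi1, phi2, phi3) /= ?(dot0l, dot0r) ?addr0 ?add0r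
  ?(@block_mxEul _ 3 11 3 11) ?(@block_mxEur _ 3 11 3 11)
  ?(@block_mxEdl _ 3 11 3 11) ?(@block_mxEdr _ 3 11 3 11)
  ?(@block_mxEul _ 3 8 3 8) ?(@block_mxEur _ 3 8 3 8)
  ?(@block_mxEdl _ 3 8 3 8) ?(@block_mxEdr _ 3 8 3 8)
  ?(@row_mxEl _ 3 3 8) ?(@row_mxEr _ 3 3 8)
  ?(@col_mxEu _ 3 8 3) ?(@col_mxEd _ 3 8 3)
  ?q0l ?q0r ?addr0 ?entry13 ?entry22
  ?trE ?zE -?entry13 //.
by rewrite /dot; ring.
Qed.

End Gram33.

Section Gram32.
Variables (K : fieldType) (N : vectType K) (br : {bilinear N -> N -> N}).
Variable x : 'I_3 -> N.
Hypothesis free_x : free_nilpotent 2 br x.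

Lemma model0_nil :
  lcs (model_br 0 : {bilinear model K -> model K -> model K}) 3 = 0%VS.
Proof.
apply/lcs3_eq0P => u v w; apply: model_eqP => //=.
  by rewrite cross0l.
by rewrite !mulmx0 !cross0l subr0.
Qed.

Let X := basis32 br x.

(** With S = 0 the model is 2-step. The value mu = -1 compensates the sign in the passage from cross
    products to the brackets [x2, x1], [x3, x1], [x3, x2]. *)
Lemma B32_model : exists phi : 'Hom(N, model K),
  [/\ lie_hom br (model_br 0) phi,
      forall i, phi (x i) = (delta_mx 0 i, 0, 0),
      forall u v, B32 br x u v = model_form 0 (- 1) (phi u) (phi v)
    & forall i j : 'I_6, B32 br x X`_i X`_j = G32 K i j].
Proof.
have [lieN nilN univ] := free_x.
have gx := free_generates (isT : 0 < 2)%N free_x.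
have sym0 : (0 : 'M[K]_3)^T = 0 by rewrite trmx0.
have [phi [[hphi phix] _]] :=
  univ _ _ (fun i => (delta_mx 0 i, 0, 0) : model K) (model_lie sym0)
    model0_nil.
have gramE : forall i j : 'I_6,
    model_form 0 (- 1) (phi X`_i) (phi X`_j) = G32 K i j; last first.
  have BE u v : B32 br x u v = model_form 0 (- 1) (phi u) (phi v).
    pose F u v := model_form 0 (- 1) (phi u) (phi v).
    apply: (gram_formE (F := F)) => [|k u1 u2 w|u1 u2|i j]; rewrite /F.
    - exact: basis32_span.
    - by rewrite linearP model_formP.
    - by rewrite model_formC.
    - exact: gramE.
  by exists phi; split=> // i j; rewrite BE gramE.
pose e (a : 'I_3) : 'rV[K]_3 := delta_mx 0 a.
pose omega (b : nat) : 'rV[K]_3 :=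
  nth 0 [:: vec3 0 0 (-1); vec3 0 1 0; vec3 (-1) 0 0] b.
have phi1 (a : 'I_3) : phi X`_(lshift 3 a) = (e a, 0, 0).
  by elim/ord3P: a => /=; apply: phix.
have phi2 (b : 'I_3) : phi X`_(rshift 3 b) = (0, omega b, 0).
  elim/ord3P: b => /=; rewrite hphi !phix; apply: model_eqP => //=;
    rewrite ?mul0mx ?cross0l ?subrr //; apply: row3P;
    rewrite !vec3E !mxE /=; ring.
have entry12 (a b : 'I_3) : - dot (e a) (omega b) = Cmx a b.
  by elim/ord3P: a; elim/ord3P: b; rewrite /omega /= /dot !vec3E !mxE /=; ring.
have zE m n i j : (0 : 'M[K]_(m, n)) i j = 0 by rewrite mxE.
have m0 u v : model_form 0 (-1) u v = dot u.1.1 v.2 + dot u.2 v.1.1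
    - (dot u.1.1 v.1.2 + dot u.1.2 v.1.1).
  by rewrite /model_form /qform mulmx0 dot0l; ring.
have CC a b : Cmx a b = Cmx b a :> K by rewrite -{1}CmxT mxE.
move=> i j; rewrite m0 /G32.
case: (@split_ordP 3 3 i) => [a ->|b ->];
case: (@split_ordP 3 3 j) => [a' ->|b' ->];
rewrite ?(phi1, phi2) /= ?(dot0l, dot0r) ?addr0 ?add0r
  ?(@block_mxEul _ 3 3 3 3) ?(@block_mxEur _ 3 3 3 3)
  ?(@block_mxEdl _ 3 3 3 3) ?(@block_mxEdr _ 3 3 3 3) ?zE ?oppr0 ?entry12 //.
by rewrite CC -entry12 /dot; ring.
Qed.

Lemma n32_presented : presented (Q := n32 br x) x (- 1) 0.
Proof.
have [lieN nilN _] := free_x; have gx := free_generates (isT : 0 < 2)%N free_x.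
have [phi [hphi phix BE gramX]] := B32_model.
split=> //=.
- split=> //=.
  + by move=> u v; rewrite !BE model_formC // trmx0.
  + by move=> u v w; rewrite !BE !hphi model_formV // trmx0.
  move=> u _ u0; have spanX := basis32_span lieN gx nilN.
  have uX := coord_span (spanX u).
  pose k : 'rV[K]_6 := \row_i coord X i u.
  have kG : k *m G32 K = 0.
    apply/rowP => j; rewrite !mxE -[RHS](u0 X`_j (memvf _)) [in RHS]uX.
    rewrite linear_sumlz /=; apply: eq_bigr => i _.
    by rewrite linearZl_LR /= gramX mxE.
  (* Nondegeneracy: the Gram matrix is an involution, so it kills no nonzero row of coordinates. *)
  have GG : G32 K *m G32 K = 1%:M.
    rewrite /G32 (@mulmx_block _ 3 3 3 3 3 3) !mulmx0 !mul0mx !CmxK.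
    by rewrite !addr0 !add0r -scalar_mx_block.
  have /rowP k0 : k = 0 by rewrite -[k]mulmx1 -GG mulmxA kG mul0mx.
  rewrite uX big1 // => i _.
  by have := k0 i; rewrite !mxE => ->; rewrite scale0r.
- apply/lcs4_eq0P => a u v w.
  by rewrite (proj1 (lcs3_eq0P br) nilN).
- by move=> c d; rewrite BE; apply: model_gram11.
- by move=> c d e; rewrite BE; apply: model_gram12.
- by move=> c d e f; rewrite BE; apply: model_gram22.
Qed.

End Gram32.

Section Quotient33.
Variables (K : fieldType) (N : vectType K) (br : {bilinear N -> N -> N}).
Variables (y : 'I_3 -> N) (A : 'M[K]_3).
Hypotheses (free_y : free_nilpotent 3 br y) (symA : A^T = A).

Lemma B33_sym : form_symmetric (B33 br y A).
Proof.
have [phi [_ _ BE]] := B33_model free_y symA => u v.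
by rewrite !BE model_formC //; apply: cross_gram_sym.
Qed.

Lemma B33_inv : form_invariant br (B33 br y A).
Proof.
have [phi [hphi _ BE]] := B33_model free_y symA => u v w.
by rewrite !BE !hphi model_formV //; apply: cross_gram_sym.
Qed.

Lemma B33_ker_ideal : lie_ideal br (form_ker (B33 br y A)).
Proof.
move=> u v /memv_form_ker u0; apply/memv_form_ker => w.
by rewrite B33_inv u0.
Qed.

Let U := form_ker (B33 br y A).

Lemma quot_form_piq u v :
  quot_form (B33 br y A) (piq U u) (piq U v) = B33 br y A u v.
Proof.
have BU n w : n \in U -> B33 br y A n w = 0 by move/memv_form_ker.
rewrite /quot_form; set u' := repq _; set v' := repq _.
have -> : B33 br y A u v = B33 br y A u' v.
  by apply/eqP; rewrite -subr_eq0 -linearBl /= BU ?repq_piq.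
apply/esym/eqP; rewrite -subr_eq0 -linearBr /= B33_sym.
by rewrite BU ?repq_piq.
Qed.

(** Every clause is an identity that transports along [pi]; an abstract surjection avoids the
    representatives chosen in the quotient. *)
Lemma presented_of_surjection (Q : metric_alg K) (pi : 'Hom(N, mcar Q)) :
  (forall a, exists u, a = pi u) -> lie_hom br (mbr Q) pi ->
  (forall u v, mform Q (pi u) (pi v) = B33 br y A u v) ->
  (forall u, (forall v, B33 br y A u v = 0) -> pi u = 0) ->
  presented (fun i => pi (y i)) 0 (cross_gram A).
Proof.
move=> piP hpi formQ ker0.
have [lieN nilN _] := free_y; have gy := free_generates (isT : 0 < 3)%N free_y.
have [brxx0 jac] := lieN.
have [phi [hphi phiy BE]] := B33_model free_y symA.
have combQ c : comb (fun i => pi (y i)) c = pi (comb y c).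
  by rewrite linear_comb.
have lcsQ u : u \in lcs br 2 -> pi u \in lcs (mbr Q) 2.
  move=> uL; elim/lcs2_ind: uL => [k a b aL bL|a b].
    by rewrite linearP rpredD ?rpredZ.
  by rewrite hpi; apply: br_lcs2.
split.
- split.
  + split=> [a|a b c].
      by have [u ->] := piP a; rewrite -hpi brxx0 linear0.
    have [[[u ->] [v ->]] [w ->]] := (piP a, piP b, piP c).
    by rewrite -!hpi -!linearD jac linear0.
  + move=> a b; have [[u ->] [v ->]] := (piP a, piP b).
    by rewrite !formQ B33_sym.
  + move=> a b c; have [[[u ->] [v ->]] [w ->]] := (piP a, piP b, piP c).
    by rewrite -!hpi !formQ B33_inv.
  + move=> a _; have [u ->] := piP a => a0; apply: ker0 => v.
    by rewrite -formQ a0 ?memvf.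
- apply/lcs4_eq0P => a b c d.
  have [[[[t ->] [u ->]] [v ->]] [w ->]] := (piP a, piP b, piP c, piP d).
  by rewrite -!hpi (proj1 (lcs4_eq0P br) nilN) linear0.
- move=> a; have [u ->] := piP a; have [c uc] := gy u; exists c.
  by rewrite combQ -linearB lcsQ.
- by move=> c d; rewrite !combQ formQ BE; apply: model_gram11.
- by move=> c d e; rewrite !combQ -hpi formQ BE; apply: model_gram12.
- by move=> c d e f; rewrite !combQ -!hpi formQ BE; apply: model_gram22.
Qed.

Lemma n33_quot_presented :
  exists z : 'I_3 -> mcar (n33_quot br y A), presented z 0 (cross_gram A).
Proof.
have [lieN _ _] := free_y.
exists (fun i => linfun (@piq K N U) (y i)).
apply: presented_of_surjection => [a|u v|u v|u u0].
- by exists (repq a); rewrite lfunE /= repqK.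
- by rewrite !lfunE /= piq_bracket //; apply: B33_ker_ideal.
- by rewrite !lfunE /=; apply: quot_form_piq.
by rewrite lfunE; apply/eqP; rewrite piq_eq0; apply/memv_form_ker.
Qed.

End Quotient33.

(** * Normalising the generators of an indecomposable algebra *)

Section GramOfGenerators.
Variables (K : fieldType) (Q : metric_alg K).
Hypothesis qQ : quadratic_lie Q.
Implicit Types z : 'I_3 -> mcar Q.

Let lieQ : lie_bracket (mbr Q). Proof. by case: qQ. Qed.
Let symQ : form_symmetric (mform Q). Proof. by case: qQ. Qed.
Let invQ : form_invariant (mbr Q) (mform Q). Proof. by case: qQ. Qed.
Let ndQ : nondegenerate_on (mform Q) fullv. Proof. by case: qQ. Qed.

(** [gram_vol] and [gram_cross] are the [mu] and [S] of generators that need not be isotropic. *)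
Definition gram_vol z : K := mform Q (z 0) (mbr Q (z 1) (z 2)).

Definition gram_cross z : 'M[K]_3 :=
  \matrix_(p, q) mform Q (cross_gen (mbr Q) z p) (cross_gen (mbr Q) z q).

Lemma form_br_rot a b c : mform Q a (mbr Q b c) = mform Q b (mbr Q c a).
Proof. by rewrite -invQ symQ -invQ symQ. Qed.

Lemma form_br_same a b : mform Q a (mbr Q a b) = 0.
Proof. by rewrite -invQ (brxx lieQ) linear0l. Qed.

Lemma form_br_samer a b : mform Q a (mbr Q b a) = 0.
Proof. by rewrite (brC lieQ) linearNr /= form_br_same oppr0. Qed.

Lemma gram_volE z c d e :
  mform Q (comb z c) (mbr Q (comb z d) (comb z e)) = gram_vol z * det3 c d e.
Proof.
rewrite (br_comb lieQ) /comb /gram_vol; have [-> -> ->] := cross_genE (mbr Q) z.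
rewrite !linearDl !linearDr !linearZl_LR !linearZr_LR /=.
rewrite !form_br_same !form_br_samer.
rewrite (form_br_rot (z 2)) (form_br_rot (z 1) (z 2)) (form_br_rot (z 2)).
by rewrite /det3 /dot; ring.
Qed.

Lemma gram_crossE z c d e f :
  mform Q (mbr Q (comb z c) (comb z d)) (mbr Q (comb z e) (comb z f))
  = qform (gram_cross z) (cross c d) (cross e f).
Proof.
rewrite !(br_comb lieQ) /comb.
rewrite !linearDl !linearDr !linearZl_LR !linearZr_LR /=.
by rewrite /qform /dot !mulmx3E !mxE; ring.
Qed.

Lemma gram_cross_sym z : (gram_cross z)^T = gram_cross z.
Proof. by apply/matrixP => i j; rewrite !mxE symQ. Qed.

Lemma generates_mod z z' : (forall i, z' i - z i \in lcs (mbr Q) 2) ->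
  generates (mbr Q) z -> generates (mbr Q) z'.
Proof.
move=> zz' gz u; have [c uc] := gz u; exists c.
have -> : u - comb z' c = (u - comb z c) - (c 0 0 *: (z' 0 - z 0)
    + c 0 1 *: (z' 1 - z 1) + c 0 2 *: (z' 2 - z 2)).
  by rewrite /comb; module_ring.
by rewrite rpredB // !rpredD ?rpredZ.
Qed.

Lemma indep_mod z z' : (forall i, z' i - z i \in lcs (mbr Q) 2) ->
  indep_mod_lcs2 (mbr Q) z -> indep_mod_lcs2 (mbr Q) z'.
Proof.
move=> zz' iz c cL; apply: iz.
have -> : comb z c = comb z' c - (c 0 0 *: (z' 0 - z 0)
    + c 0 1 *: (z' 1 - z 1) + c 0 2 *: (z' 2 - z 2)).
  by rewrite /comb; module_ring.
by rewrite rpredB // !rpredD ?rpredZ.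
Qed.

Section Indecomposable.
Hypotheses (nz2 : (2 : K) != 0) (ndecQ : ~ decomposable Q).
Hypotheses (type3 : lie_type Q = 3%N) (nilQ : lcs (mbr Q) 4 = 0%VS).

(** Add to z_i the central w_i whose pairing with z_j is minus half that of z_i with z_j.
    Indecomposability puts w_i in the square, so the w_i pair to 0 with each other and with all
    brackets; being central, they change no bracket. *)
Lemma isotropic_generators z :
  generates (mbr Q) z -> indep_mod_lcs2 (mbr Q) z ->
  exists z', [/\ generates (mbr Q) z', forall i j, mform Q (z' i) (z' j) = 0,
    gram_vol z' = gram_vol z & gram_cross z' = gram_cross z].
Proof.
move=> gz iz.
have ex_w i : exists2 w, forall u, mbr Q w u = 0 &
    forall j, mform Q w (z j) = - (2^-1 * mform Q (z i) (z j)).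
  have [f [flin f0 fz]] :=
    lcs2_coordinates gz iz (fun j => - (2^-1 * mform Q (z i) (z j))).
  have [w wf] := riesz ndQ flin; exists w => [u|j]; last by rewrite wf fz.
  by apply: orth_lcs2_central => // x xL; rewrite wf f0.
have [w w0 wz] : exists2 w : 'I_3 -> mcar Q, forall i u, mbr Q (w i) u = 0 &
    forall i j, mform Q (w i) (z j) = - (2^-1 * mform Q (z i) (z j)).
  have [w0 h0 k0] := ex_w 0; have [w1 h1 k1] := ex_w 1.
  have [w2 h2 k2] := ex_w 2.
  by exists (tnth [tuple w0; w1; w2]); apply: ord3P.
have wL i : w i \in lcs (mbr Q) 2 by apply: central_in_lcs2.
pose z' i := z i + w i.
have br' i j : mbr Q (z' i) (z' j) = mbr Q (z i) (z j).
  rewrite linearDl !linearDr /= !w0 (brC lieQ (z i) (w j)) w0.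
  by rewrite oppr0 !addr0.
exists z'; split.
- by apply: generates_mod gz => i; rewrite addrAC subrr add0r.
- move=> i j; rewrite linearDl !linearDr /= (symQ (z i) (w j)) !wz.
  rewrite (central_orth_lcs2 qQ (w0 i) (wL j)) (symQ (z j)) addr0.
  by field.
- rewrite /gram_vol br' linearDl /= (central_orth_lcs2 qQ (w0 0)) ?br_lcs2 //.
  by rewrite addr0.
by apply/matrixP => p q; rewrite !mxE /cross_gen !br'.
Qed.

(** For s, t in the kernel of S and v = s x t, each v x d is again in the kernel. As mu = 0, the
    element [comb z v] is then central, so it lies in the square and v = 0. *)
Lemma rank_ge2_gram_cross z :
  generates (mbr Q) z -> indep_mod_lcs2 (mbr Q) z -> gram_vol z = 0 ->
  rank_ge2 (gram_cross z).
Proof.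
move=> gz iz vol0 s t sS tS; set v := cross s t.
have vS d : cross v d *m gram_cross z = 0.
  rewrite cross_cross_l mulmxBl -!scalemxAl sS tS !scaler0 subr0 //.
apply: iz; apply: central_in_lcs2 => // a.
set u := comb z v.
have u22 b n : n \in lcs (mbr Q) 2 -> mform Q (mbr Q u b) n = 0.
  move=> nL; elim/lcs2_ind: nL => [k x y x0 y0|x y].
    by rewrite linearPr x0 y0 mulr0 addr0.
  have [d bd] := gz b; have [e xe] := gz x; have [f yf] := gz y.
  rewrite (form_br_mod_lcs2 qQ nilQ (a' := u) _ bd xe yf) ?subrr ?mem0v //.
  by rewrite gram_crossE /qform vS dot0l.
apply: ndQ; rewrite ?memvf // => b _.
have [e be] := gz b; have [d ad] := gz a.
rewrite -[b](subrK (comb z e)) linearDr /= u22 // add0r.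
have -> : mform Q (mbr Q u a) (comb z e)
    = mform Q (mbr Q u (a - comb z d)) (comb z e)
      + mform Q (mbr Q u (comb z d)) (comb z e).
  by rewrite -linearDl -linearDr /= subrK.
rewrite [X in _ + X]invQ gram_volE vol0 mul0r addr0.
by rewrite invQ form_br_rot (brC lieQ) linearNr /= symQ u22 // oppr0.
Qed.

(** Choose p, q with S_pq nonzero and add t C_q to z_p: the volume changes by t S_pq, which fixes t;
    for degree reasons there is no higher order term. *)
Lemma exists_vol0 z : gram_cross z != 0 ->
  exists2 z', forall i, z' i - z i \in lcs (mbr Q) 2 & gram_vol z' = 0.
Proof.
move=> nzS; have [p [q nz_pq]] : exists p q, gram_cross z p q != 0.
  have /forallPn[p /forallPn[q pq]] :
      ~~ [forall p, forall q, gram_cross z p q == 0].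
    apply: contra nzS => /forallP S0.
    apply/eqP/matrixP => p q; rewrite [RHS]mxE.
    by have /forallP/(_ q)/eqP := S0 p.
  by exists p, q.
pose t := - gram_vol z / gram_cross z p q.
pose C := cross_gen (mbr Q) z.
pose w i : mcar Q := (i == p)%:R * t *: C q.
have wL i : w i \in lcs (mbr Q) 2 by rewrite rpredZ // br_lcs2.
exists (fun i => z i + w i) => [i|]; first by rewrite addrAC subrr add0r.
have w3 i j a : mform Q (w i) (mbr Q (w j) a) = 0.
  rewrite symQ; have := wL i; elim/lcs2_ind => [k x y x0 y0|x y].
    by rewrite linearPr x0 y0 mulr0 addr0.
  exact: form_br_lcs2.
have [C0 C1 C2] := cross_genE (mbr Q) z; rewrite -/C in C0 C1 C2.
have -> : gram_vol (fun i => z i + w i) = gram_vol z + mform Q (w 0) (C 0)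
    + mform Q (w 1) (C 1) + mform Q (w 2) (C 2).
  have w3r i j a : mform Q (w i) (mbr Q a (w j)) = 0.
    by rewrite (brC lieQ) linearNr /= w3 oppr0.
  have -> : mform Q (w 1) (C 1) = mform Q (z 0) (mbr Q (w 1) (z 2)).
    by rewrite C1 [RHS]form_br_rot.
  have -> : mform Q (w 2) (C 2) = mform Q (z 0) (mbr Q (z 1) (w 2)).
    by rewrite C2 2![RHS]form_br_rot.
  have w4 : mform Q (z 0) (mbr Q (w 1) (w 2)) = 0 by rewrite form_br_rot w3.
  rewrite C0 /gram_vol; move: w3 w3r w4; clearbody w => w3 w3r w4.
  rewrite linearDl linearDl !linearDr !w3 !w3r w4 /=; ring.
rewrite /w !linearZl_LR /=.
have -> : gram_vol z + (0 == p)%:R * t * mform Q (C q) (C 0)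
  + (1 == p)%:R * t * mform Q (C q) (C 1)
  + (2 == p)%:R * t * mform Q (C q) (C 2)
  = gram_vol z + t * gram_cross z p q.
  rewrite mxE -/C (symQ (C p)).
  elim/ord3P: (p) => /=; ring.
by rewrite /t divfK // subrr.
Qed.

End Indecomposable.
End GramOfGenerators.

Section Classification.
Variables (K : fieldType) (Q : metric_alg K).

Lemma presented_of_gram (z : 'I_3 -> mcar Q) :
  quadratic_lie Q -> lcs (mbr Q) 4 = 0%VS -> generates (mbr Q) z ->
  (forall i j, mform Q (z i) (z j) = 0) ->
  presented z (gram_vol z) (gram_cross z).
Proof.
move=> qQ nilQ gz z0; split=> //.
- move=> c d; rewrite /comb !linearDl !linearDr !linearZl_LR !linearZr_LR /=.
  by rewrite !z0; ring.
- by move=> c d e; apply: gram_volE.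
- by move=> c d e f; apply: gram_crossE.
Qed.

Lemma generates_scale (z : 'I_3 -> mcar Q) a : a != 0 ->
  let z' i := if i == 0 then a *: z i else z i in
  [/\ generates (mbr Q) z -> generates (mbr Q) z',
      indep_mod_lcs2 (mbr Q) z -> indep_mod_lcs2 (mbr Q) z'
    & gram_vol z' = a * gram_vol z].
Proof.
move=> nz_a z'.
have comb' c : comb z' c = comb z (vec3 (a * c 0 0) (c 0 1) (c 0 2)).
  by rewrite /comb !vec3E /z' /= scalerA mulrC.
split=> [gz u | iz c | ].
- have [c uc] := gz u; exists (vec3 (a^-1 * c 0 0) (c 0 1) (c 0 2)).
  rewrite comb' !vec3E mulVKf //.
  by have -> : vec3 (c 0 0) (c 0 1) (c 0 2) = c by apply: row3P; rewrite !vec3E.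
- rewrite comb' => /iz /rowP c0; apply: row3P; rewrite mxE.
  + have := c0 0; rewrite vec3E mxE => /eqP.
    by rewrite mulf_eq0 (negPf nz_a) => /eqP.
  + by have := c0 1; rewrite vec3E mxE.
  by have := c0 2; rewrite vec3E mxE.
by rewrite /gram_vol /z' /= linearZl_LR.
Qed.

Lemma in_class_presented : (2 : K) != 0 -> in_class Q ->
  (exists z : 'I_3 -> mcar Q, presented z (- 1) 0) \/
  (exists (z : 'I_3 -> mcar Q) S, [/\ S^T = S, rank_ge2 S & presented z 0 S]).
Proof.
move=> nz2 [qQ ndecQ type3 nilQ]; have [lieQ symQ invQ ndQ] := qQ.
have nil4 : lcs (mbr Q) 4 = 0%VS.
  case: nilQ => [[L3 _]|[]//]; apply/lcs4_eq0P => a u v w.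
  by rewrite (proj1 (lcs3_eq0P _) L3).
have [z gz iz] := lie_type3_generators type3.
case: nilQ => [[L3 nzL2] | [_ nzL3]]; [left|right].
  have br3 := proj1 (lcs3_eq0P _) L3.
  have S0 (z' : 'I_3 -> mcar Q) : gram_cross z' = 0.
    by apply/matrixP => p q; rewrite !mxE -invQ br3 linear0l.
  (* When n^3 = 0 and mu = 0, every bracket is orthogonal to the whole algebra, so the square would
     vanish. *)
  have nz_mu : gram_vol z != 0.
    apply: contra nzL2 => /eqP mu0; rewrite -subv0.
    apply/(commv_subP (mbr Q) fullv fullv) => a b _ _.
    rewrite memv0; apply/eqP/ndQ; rewrite ?memvf // => v _.
    rewrite symQ.
    have [c ac] := gz a; have [d bd] := gz b; have [e ve] := gz v.
    have brL n u : n \in lcs (mbr Q) 2 -> mbr Q n u = 0.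
      move=> nL; elim/lcs2_ind: nL => [k x y x0 y0|x y]; last exact: br3.
      by rewrite linearPl x0 y0 scaler0 addr0.
    have brE x x' w : x - x' \in lcs (mbr Q) 2 -> mbr Q x w = mbr Q x' w.
      by move=> /brL xx'; apply/eqP; rewrite -subr_eq0 -linearBl /= xx'.
    rewrite (brE _ _ _ ac) (brC lieQ) (brE _ _ _ bd) (brC lieQ) opprK.
    rewrite -[v](subrK (comb z e)) linearDl /= gram_volE // mu0 mul0r addr0.
    by rewrite -invQ brL // linear0l.
  (* Scaling one generator by this factor makes mu equal to -1. *)
  have nza : - (gram_vol z)^-1 != 0 by rewrite oppr_eq0 invr_eq0.
  have [/(_ gz) gz1 /(_ iz) iz1 vol1] := generates_scale z nza.
  have [z2 [gz2 iso2 vol2 cross2]] :=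
    isotropic_generators qQ nz2 ndecQ type3 gz1 iz1.
  exists z2; have := presented_of_gram qQ nil4 gz2 iso2.
  by rewrite S0 vol2 vol1 mulNr mulVf.
(* The pairing of [[a, b], c] with v is that of [a, b] with [c, v]; so S = 0 would give n^3 = 0. *)
have nzS : gram_cross z != 0.
  apply: contra nzL3 => /eqP S0; apply/eqP/lcs3_eq0P => a b c.
  apply: ndQ; rewrite ?memvf // => v _; rewrite invQ.
  have [ca ha] := gz a; have [cb hb] := gz b.
  have [cc hc] := gz c; have [cv hv] := gz v.
  by rewrite (form_br_mod_lcs2 qQ nil4 ha hb hc hv) gram_crossE // S0
    /qform mulmx0 dot0l.
have [z1 zz1 vol1] := exists_vol0 qQ nil4 nzS.
have gz1 := generates_mod zz1 gz; have iz1 := indep_mod zz1 iz.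
have rk1 := rank_ge2_gram_cross qQ nz2 ndecQ type3 nil4 gz1 iz1 vol1.
have [z2 [gz2 iso2 vol2 cross2]] :=
  isotropic_generators qQ nz2 ndecQ type3 gz1 iz1.
exists z2, (gram_cross z2); split.
- exact: gram_cross_sym.
- by rewrite cross2.
by have := presented_of_gram qQ nil4 gz2 iso2; rewrite vol2 vol1.
Qed.

End Classification.

(** * Cofactor matrices and congruence *)

Section Congruence.
Variable K : fieldType.
Implicit Types A B P R : 'M[K]_3.

Lemma Cmx_unit : (Cmx : 'M[K]_3) \in unitmx.
Proof. by case: (mulmx1_unit (CmxK K)). Qed.

Lemma cross_gramK A : cross_gram (cross_gram A) = A.
Proof.
by rewrite /cross_gram !mulmxA CmxK mul1mx -mulmxA CmxK mulmx1.
Qed.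

Lemma rank_cross_gram A : \rank (cross_gram A) = \rank A.
Proof.
rewrite /cross_gram mxrankMfree ?row_free_unit ?Cmx_unit //.
have fullC : row_full (Cmx : 'M[K]_3) by rewrite row_full_unit Cmx_unit.
by rewrite (eqmxMfull A fullC).
Qed.

Lemma Adj_unit P : P \in unitmx -> Adj P \in unitmx.
Proof.
move=> uP; have AdjE : Adj P = (\adj P)^T by apply/matrixP => i j; rewrite !mxE.
have /mulmx1_unit[]// : Adj P *m ((\det P)^-1 *: P^T) = 1%:M.
rewrite AdjE -scalemxAr -trmx_mul mul_mx_adj tr_scalar_mx scale_scalar_mx.
by rewrite mulVf // -unitfE.
Qed.

Lemma det_mx33 R : \det R = R 0 0 * cofactor R 0 0 + R 0 1 * cofactor R 0 1
  + R 0 2 * cofactor R 0 2.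
Proof. by rewrite (expand_det_row _ 0) sum3E. Qed.

(** For m the inverse of a square root of det R or of - det R, this exhibits R up to sign as a
    cofactor matrix. *)
Lemma Adj_Adj R m : Adj (m *: Adj R) = (m ^+ 2 * \det R) *: R.
Proof.
have [[a00 a01 a02] [[a10 a11 a12] [a20 a21 a22]]] := cofactor3E (m *: Adj R).
have [[b00 b01 b02] [[b10 b11 b12] [b20 b21 b22]]] := cofactor3E R.
apply/matrixP; do 2![apply: ord3P]; rewrite [LHS]mxE
  ?(a00, a01, a02, a10, a11, a12, a20, a21, a22) !mxE
  det_mx33 ?(b00, b01, b02, b10, b11, b12, b20, b21, b22); ring.
Qed.

Lemma Adj_congr_congruent A B P : P \in unitmx ->
  cross_gram B = (Adj P)^T *m cross_gram A *m Adj P -> congruent A B.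
Proof.
move=> uP eqB; exists (Cmx *m Adj P *m Cmx).
  by rewrite !unitmx_mul Cmx_unit Adj_unit.
rewrite -(cross_gramK B) {1}/cross_gram eqB /cross_gram.
by rewrite !trmx_mul CmxT !mulmxA.
Qed.

Lemma congruent_Adj_congr A B :
  (forall a : K, exists b, a = b ^+ 2 \/ - a = b ^+ 2) -> congruent A B ->
  exists2 P, P \in unitmx &
    cross_gram B = (Adj P)^T *m cross_gram A *m Adj P.
Proof.
move=> sq [T uT ->]; pose R := Cmx *m T *m Cmx.
have uR : R \in unitmx by rewrite !unitmx_mul Cmx_unit uT.
have nzd : \det R != 0 by rewrite -unitfE.
have [b bE] := sq (\det R).
have nzb : b != 0.
  apply: contraNneq nzd => b0; case: bE; rewrite b0 expr0n /= => /eqP;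
    by rewrite ?oppr_eq0.
exists (b^-1 *: Adj R); first by rewrite unitmxZ ?Adj_unit // unitfE invr_eq0.
have [s s2 ->] : exists2 s : K, s * s = 1 & Adj (b^-1 *: Adj R) = s *: R.
  case: bE => bE; [exists 1|exists (-1)]; rewrite ?mulrNN ?mulr1 // Adj_Adj.
    by rewrite bE -exprMn mulVf // expr1n.
  by rewrite -[\det R]opprK bE mulrN -exprMn mulVf // expr1n.
rewrite [(s *: R)^T]linearZ /= -!scalemxAl -scalemxAr scalerA s2 scale1r.
rewrite /cross_gram /R.
rewrite !trmx_mul CmxT !mulmxA.
by rewrite -!mulmxA !(mulmxA Cmx Cmx) CmxK !mul1mx !mulmxA.
Qed.

Lemma square_up_to_sign :
  (forall a : K, exists b : K, a = b ^+ 2) \/ is_reals K ->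
  forall a : K, exists b, a = b ^+ 2 \/ - a = b ^+ 2.
Proof.
case=> [sq a | [R [f [g fK gK]]] a].
  by have [b ->] := sq a; exists b; left.
pose b := Num.sqrt `|f a|; exists (g b).
have fb : f (g b ^+ 2) = `|f a| by rewrite rmorphXn /= gK Num.Theory.sqr_sqrtr.
have [fa|fa] := Num.Theory.ger0P (f a); [left|right]; apply: (can_inj fK).
  by rewrite fb Num.Theory.ger0_norm.
by rewrite fb rmorphN Num.Theory.ltr0_norm.
Qed.

End Congruence.

(** Separates family (i), where n^3 = 0, from family (ii). *)
Lemma isometric_lcs3 (K : fieldType) (Q Q' : metric_alg K) :
  isometric Q Q' -> lcs (mbr Q) 3 = 0%VS -> lcs (mbr Q') 3 = 0%VS.
Proof.
move=> [f [[g fK gK] hf _]] L3; apply/lcs3_eq0P => u v w.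
by rewrite -[u]gK -[v]gK -[w]gK -!hf (proj1 (lcs3_eq0P _) L3) linear0.
Qed.

Lemma sym_rank_ge2_cross_gram (K : fieldType) (A : 'M[K]_3) :
  sym_rank_ge2 A -> rank_ge2 (cross_gram A).
Proof. by move=> [_ rA]; apply/rank_ge2P; rewrite rank_cross_gram. Qed.

Theorem corollary5p7 (K : fieldType) (charK0 : [pchar K] =i pred0)
    (N2 : vectType K) (br2 : {bilinear N2 -> N2 -> N2}) (x : 'I_3 -> N2)
    (N3 : vectType K) (br3 : {bilinear N3 -> N3 -> N3}) (y : 'I_3 -> N3)
    (free2 : free_nilpotent 2 br2 x) (free3 : free_nilpotent 3 br3 y) :
  (* (i) and (ii) are algebras of the announced kind *)
  (in_class (n32 br2 x)
   /\ forall A, sym_rank_ge2 A ->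
        [/\ form_symmetric (B33 br3 y A),
            form_invariant br3 (B33 br3 y A),
            lie_ideal br3 (form_ker (B33 br3 y A))
          & in_class (n33_quot br3 y A)])
  (* they exhaust the class up to isometry, and (i) is not isometric to (ii) *)
  /\ (forall Q : metric_alg K, in_class Q ->
        isometric Q (n32 br2 x)
        \/ exists2 A, sym_rank_ge2 A & isometric Q (n33_quot br3 y A))
  /\ (forall A, sym_rank_ge2 A -> ~ isometric (n32 br2 x) (n33_quot br3 y A))
  (* isometry within family (ii) *)
  /\ (forall A B, sym_rank_ge2 A -> sym_rank_ge2 B ->
        (isometric (n33_quot br3 y A) (n33_quot br3 y B)
         <-> exists2 P : 'M[K]_3, P \in unitmx &
               Cmx *m B *m Cmx = (Adj P)^T *m (Cmx *m A *m Cmx) *m Adj P))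
  /\ ((forall a : K, exists b : K, a = b ^+ 2) \/ is_reals K ->
      forall A B, sym_rank_ge2 A -> sym_rank_ge2 B ->
        (isometric (n33_quot br3 y A) (n33_quot br3 y B) <-> congruent A B)).
Proof.
have nz2 : (2 : K) != 0 by apply/negP => K2; have := charK0 2; rewrite !inE K2.
have [lie2 nil2 _] := free2; have [lie3 nil3 _] := free3.
have gy := free_generates (isT : 0 < 3)%N free3.
have p32 := n32_presented free2.
have p33 A : sym_rank_ge2 A ->
    exists z : 'I_3 -> mcar (n33_quot br3 y A), presented z 0 (cross_gram A).
  by case=> symA _; apply: n33_quot_presented.
have isoP A B : sym_rank_ge2 A -> sym_rank_ge2 B ->
    isometric (n33_quot br3 y A) (n33_quot br3 y B)
    <-> exists2 P : 'M[K]_3, P \in unitmx &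
          cross_gram B = (Adj P)^T *m cross_gram A *m Adj P.
  move=> rA rB; have [z pz] := p33 A rA; have [z' pz'] := p33 B rB.
  split=> [isoAB | [P uP eqB]].
    apply: (isometric_presented_congr pz pz') isoAB.
    exact: sym_rank_ge2_cross_gram.
  apply: (isometric_of_presented free3 gy) (presented_change pz uP) _.
  by rewrite -eqB; apply: pz'.
split; [split|split; [|split; [|split]]].
- by apply: (presented_in_class2 p32); rewrite ?oppr_eq0 ?oner_eq0.
- move=> A rA; have [symA _] := rA; have [z pz] := p33 A rA; split.
  + exact: B33_sym.
  + exact: B33_inv.
  + exact: B33_ker_ideal.
  exact: presented_in_class3 pz (sym_rank_ge2_cross_gram rA).
- move=> Q /(in_class_presented nz2) [[z pz]|[z [S [symS rS pz]]]];
    [left|right].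
    exact: isometric_of_presented free3 gy pz p32.
  (* The witness is A = C S C: as C squares to 1, the data of its quotient are S again. *)
  have rA : sym_rank_ge2 (cross_gram S).
    split; first exact: cross_gram_sym.
    by rewrite rank_cross_gram; apply/rank_ge2P.
  exists (cross_gram S) => //; have [z' pz'] := p33 _ rA.
  rewrite cross_gramK in pz'; exact: isometric_of_presented free3 gy pz pz'.
- move=> A rA /isometric_lcs3/(_ nil2); have [z pz] := p33 A rA.
  exact: presented_lcs3_neq0 pz (sym_rank_ge2_cross_gram rA).
- exact: isoP.
move=> /square_up_to_sign sq A B rA rB.
split=> [/(isoP A B rA rB) [P uP] | cAB].
  exact: Adj_congr_congruent.
by apply/(isoP A B rA rB); apply: congruent_Adj_congr.
Qed.
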